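(* Every non-separable convex subset of a Fréchet space has the locally finite approximation property (LFAP).
   Context: A Fréchet space is a locally convex complete linear metric space, where a linear metric space is a topological vector space whose topology is generated by a translation-invariant metric. A topological space $X$ has the locally finite approximation property (LFAP) if for each open cover $\mathcal U$ of $X$ there is a sequence of continuous maps $f_n:X\to X$, $n\in\omega$, such that each $f_n$ is $\mathcal U$-near to the identity $\mathrm{id}_X$ (i.e. for every $x\in X$ there is $U\in\mathcal U$ containing both $x$ and $f_n(x)$) and the family $(f_n(X))_{n\in\omega}$ is locally finite in $X$ (each point of $X$ has a neighborhood meeting only finitely many of the sets $f_n(X)$). *)

(* Defs.v *)
From Stdlib Require Import Reals.
Open Scope R_scope.

Record RVectorSpace (E : Type) := {
  vzero : E;
  vadd : E -> E -> E;
  vopp : E -> E;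
  vscale : R -> E -> E;
  vadd_assoc : forall x y z, vadd x (vadd y z) = vadd (vadd x y) z;
  vadd_comm : forall x y, vadd x y = vadd y x;
  vadd_zero : forall x, vadd x vzero = x;
  vadd_opp : forall x, vadd x (vopp x) = vzero;
  vscale_one : forall x, vscale 1 x = x;
  vscale_assoc : forall a b x, vscale a (vscale b x) = vscale (a * b) x;
  vscale_distr_v : forall a x y, vscale a (vadd x y) = vadd (vscale a x) (vscale a y);
  vscale_distr_s : forall a b x, vscale (a + b) x = vadd (vscale a x) (vscale b x)
}.

Arguments vzero {E} _.
Arguments vadd {E} _ _ _.
Arguments vopp {E} _ _.
Arguments vscale {E} _ _ _.

Definition is_metric {E : Type} (d : E -> E -> R) : Prop :=
  (forall x y, 0 <= d x y) /\
  (forall x y, d x y = 0 <-> x = y) /\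
  (forall x y, d x y = d y x) /\
  (forall x y z, d x z <= d x y + d y z).

Definition ball {E : Type} (d : E -> E -> R) (x : E) (r : R) : E -> Prop :=
  fun y => d x y < r.

Definition metric_open {E : Type} (d : E -> E -> R) (U : E -> Prop) : Prop :=
  forall x, U x -> exists r, 0 < r /\ forall y, d x y < r -> U y.

Definition convex {E : Type} (V : RVectorSpace E) (C : E -> Prop) : Prop :=
  forall x y t, C x -> C y -> 0 <= t <= 1 ->
    C (vadd V (vscale V t x) (vscale V (1 - t) y)).

Definition frechet_space {E : Type} (V : RVectorSpace E) (d : E -> E -> R) : Prop :=
  is_metric d /\
  (forall x y z, d (vadd V x z) (vadd V y z) = d x y) /\
  (forall x y eps, 0 < eps -> exists delta, 0 < delta /\
     forall x' y', d x x' < delta -> d y y' < delta ->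
       d (vadd V x y) (vadd V x' y') < eps) /\
  (forall a x eps, 0 < eps -> exists delta, 0 < delta /\
     forall a' x', Rabs (a - a') < delta -> d x x' < delta ->
       d (vscale V a x) (vscale V a' x') < eps) /\
  (forall eps, 0 < eps -> exists C, convex V C /\ metric_open d C /\
     C (vzero V) /\ forall y, C y -> d (vzero V) y < eps) /\
  (forall u : nat -> E,
     (forall eps, 0 < eps -> exists N, forall m n, (N <= m)%nat -> (N <= n)%nat ->
        d (u m) (u n) < eps) ->
     exists l, forall eps, 0 < eps -> exists N, forall n, (N <= n)%nat -> d (u n) l < eps).

Definition open_in {E : Type} (d : E -> E -> R) (X U : E -> Prop) : Prop :=
  (forall x, U x -> X x) /\
  forall x, U x -> exists r, 0 < r /\ forall y, X y -> d x y < r -> U y.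

Definition separable {E : Type} (d : E -> E -> R) (X : E -> Prop) : Prop :=
  (forall x, ~ X x) \/
  exists s : nat -> E, (forall n, X (s n)) /\
    forall x eps, X x -> 0 < eps -> exists n, d x (s n) < eps.

Definition continuous_on_into {E : Type} (d : E -> E -> R) (X : E -> Prop) (f : E -> E) : Prop :=
  (forall x, X x -> X (f x)) /\
  forall x eps, X x -> 0 < eps -> exists delta, 0 < delta /\
    forall y, X y -> d x y < delta -> d (f x) (f y) < eps.

Definition LFAP {E : Type} (d : E -> E -> R) (X : E -> Prop) : Prop :=
  forall cover : (E -> Prop) -> Prop,
    (forall U, cover U -> open_in d X U) ->
    (forall x, X x -> exists U, cover U /\ U x) ->
    exists f : nat -> E -> E,
      (forall n, continuous_on_into d X (f n)) /\
      (forall n x, X x -> exists U, cover U /\ U x /\ U (f n x)) /\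
      (forall x, X x -> exists W, open_in d X W /\ W x /\
         exists N, forall n, (exists y, X y /\ W (f n y)) -> (n < N)%nat).

(* Main.v *)
Require Import Defs.
From Stdlib Require Import Reals.
From Stdlib Require Import ZArith Lra Lia List Classical ClassicalEpsilon Cantor.
From mathcomp Require boolp wochoice eqtype.

(** Non-separability gives a continuous seminorm [q] and a bounded sequence [z m] in [X] such
    that every [z m] has [q]-distance at least [1/2] from [F m], the span of the earlier [z j].
    The approximations are [f n x = (1 - t x) x + t x w], where the step [t x] is small
    compared with the cover and [w] lies on a segment between two of the [z m], with indices
    that are large for [x] and differ for different [n].

    The point of the proof is to say when an index is large for [x] although [x] need not be
    close to the span of the [z m]. Moving by [w] does not change the class of [x] modulo the
    union of the [F m], so [f n x] and [t x] determine the class of [x / t x]. A locally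
    finite choice of representatives [a] of these classes, up to a small error, gives
    vectors [x / t x - a] that are close to some [F k], and this [k] is the bound for the
    indices. If infinitely many [f n x] were close to one point, then infinitely many of
    these [x / t x] would share the same [a]; subtracting it leaves vectors near the span of
    the [z m] whose leading terms are in different directions, so they cannot be close. *)

(** * Well-orderings and elementary facts on infima, least numbers and lists *)

Lemma well_ordered_type (E : Type) : exists le : E -> E -> Prop,
  (forall x y, le x y -> le y x -> x = y) /\
  (forall A : E -> Prop, (exists x, A x) -> exists x, A x /\ forall y, A y -> le x y).
Proof.
  pose (T := eqtype.Equality.Pack (eqtype.Equality.Class (boolp.gen_eqMixin E))).
  destruct (wochoice.well_ordering_principle T) as [R HR].
  pose (le := fun x y : E => R x y = true).
  assert (Hmin : forall A : E -> Prop, (exists x, A x) ->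
            exists x, (A x /\ forall y, A y -> le x y) /\
              forall x', (A x' /\ forall y, A y -> le x' y) -> x = x').
  { intros A [x Ax].
    pose (B := fun z : E => if excluded_middle_informative (A z) then true else false).
    assert (HB : forall z, B z = true <-> A z).
    { intros z; unfold B; destruct (excluded_middle_informative (A z));
        split; intros; auto; discriminate. }
    destruct (HR B) as [m [[Bm Hm] Hu]].
    { exists x; apply HB; exact Ax. }
    exists m; split.
    - split; [apply HB, Bm | intros y Ay; apply Hm, HB, Ay].
    - intros x' [Ax' Hx']; apply Hu; split; [apply HB, Ax' | intros y By; apply Hx', HB, By]. }
  exists le; split.
  - intros x y Hxy Hyx.
    assert (Hrefl : forall z, le z z).
    { intros z; destruct (Hmin (eq z)) as [m [[<- Hm] _]]; [exists z | apply Hm]; reflexivity. }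
    (* Antisymmetry comes from the uniqueness of the least element of the pair [x], [y]. *)
    destruct (Hmin (fun z => z = x \/ z = y)) as [m [_ Hu]]; [exists x; auto|].
    transitivity m; [symmetry|]; apply Hu; (split; [auto|]); intros z [-> | ->]; auto.
  - intros A HA; destruct (Hmin A HA) as [m [Hm _]]; exists m; exact Hm.
Qed.

Lemma infimum_exists (S : R -> Prop) :
  (exists x, S x) -> (forall x, S x -> 0 <= x) ->
  exists m, (forall x, S x -> m <= x) /\ forall e, 0 < e -> exists x, S x /\ x < m + e.
Proof.
  intros [x0 Hx0] Hpos.
  destruct (completeness (fun y => S (- y))) as [m [Hub Hlub]].
  - exists 0; intros y Hy; specialize (Hpos _ Hy); lra.
  - exists (- x0); now rewrite Ropp_involutive.
  - exists (- m); split.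
    + intros x Hx; assert (- x <= m) by (apply Hub; now rewrite Ropp_involutive); lra.
    + intros e He; apply NNPP; intros Hno.
      assert (m <= m - e); [|lra].
      apply Hlub; intros y Hy.
      destruct (Rle_dec y (m - e)); [assumption|].
      exfalso; apply Hno; exists (- y); split; [assumption|lra].
Qed.

Lemma least_nat (P : nat -> Prop) : (exists n, P n) ->
  exists n, P n /\ forall k, (k < n)%nat -> ~ P k.
Proof.
  intros [n Hn]; revert Hn.
  induction n as [n IH] using (well_founded_induction Wf_nat.lt_wf); intros Hn.
  destruct (classic (exists k, (k < n)%nat /\ P k)) as [[k [Hk Pk]] | Hno].
  - exact (IH k Hk Pk).
  - exists n; split; [assumption|]; intros k Hk Pk; apply Hno; now exists k.
Qed.

(** Infinite pigeonhole principle; [Phi] carries a side condition along the sequence. *)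
Lemma frequently_in_list {B : Type} (Phi : nat -> Prop) (g : nat -> B) (L : list B) :
  (forall N, exists j, (N <= j)%nat /\ Phi j /\ In (g j) L) ->
  exists b, In b L /\ forall N, exists j, (N <= j)%nat /\ Phi j /\ g j = b.
Proof.
  induction L as [|b L IH]; intros H.
  - destruct (H 0%nat) as [j [_ [_ []]]].
  - destruct (classic (forall N, exists j, (N <= j)%nat /\ Phi j /\ g j = b)) as [Hb | Hb].
    + exists b; split; [now left | assumption].
    + apply not_all_ex_not in Hb; destruct Hb as [N0 HN0].
      destruct IH as [c [Hc HcN]].
      * intros N; destruct (H (Nat.max N N0)) as [j [Hj [Pj [Ej | Ij]]]].
        -- exfalso; apply HN0; exists j; repeat split; [lia | assumption | now symmetry].
        -- exists j; repeat split; [lia | assumption | assumption].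
      * exists c; split; [now right | assumption].
Qed.

(** * Locally finite choice of nearby points *)

Section Selection.
Context {E : Type} (rho : E -> E -> R).
Hypothesis rho_pos : forall x y, 0 <= rho x y.
Hypothesis rho_refl : forall x, rho x x = 0.
Hypothesis rho_sym : forall x y, rho x y = rho y x.
Hypothesis rho_tri : forall x y z, rho x z <= rho x y + rho y z.

Context (le : E -> E -> Prop).
Hypothesis le_anti : forall x y, le x y -> le y x -> x = y.
Hypothesis le_min : forall A : E -> Prop, (exists x, A x) ->
  exists x, A x /\ forall y, A y -> le x y.

(* [x] lies at depth [e] in the set of points that are closer than [1] to [b]
   and to no predecessor of [b]; depth is stable under small moves of [x],
   and positive depth occurs at some [b] for every [x]. *)
Definition depth_at_least (b x : E) (e : R) : Prop :=
  rho x b + e <= 1 /\ forall c, le c b -> c <> b -> rho x b + e <= rho x c.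

Lemma depth_move b x y e r :
  depth_at_least b x e -> rho x y <= r -> depth_at_least b y (e - 2 * r).
Proof.
  intros [H1 H2] Hr; pose proof (rho_pos x y); split.
  - pose proof (rho_tri y x b); rewrite (rho_sym y x) in *; lra.
  - intros c Hc Hcb; specialize (H2 c Hc Hcb).
    pose proof (rho_tri y x b); pose proof (rho_tri x y c); rewrite (rho_sym y x) in *; lra.
Qed.

Lemma depth_anti b x e e' : depth_at_least b x e -> e' <= e -> depth_at_least b x e'.
Proof.
  intros [H1 H2] He; split; [lra|]; intros c Hc Hcb; specialize (H2 c Hc Hcb); lra.
Qed.

(** Take for [b] the first point closer than [1] to [x]: all its predecessors are at distance at
    least [1]. *)
Lemma depth_exists x : exists b e, 0 < e /\ depth_at_least b x e.
Proof.
  destruct (le_min (fun b => rho x b < 1)) as [b [Hb Hmin]].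
  { exists x; rewrite rho_refl; lra. }
  exists b, (1 - rho x b); split; [lra|]; split; [lra|].
  intros c Hc Hcb; destruct (Rlt_le_dec (rho x c) 1) as [Hlt|]; [|lra].
  elim Hcb; apply le_anti; auto.
Qed.

(** Whichever of [b], [b'] comes first is a competitor in the depth condition of the other. *)
Lemma depth_separated b b' x e :
  depth_at_least b x e -> depth_at_least b' x e -> b <> b' ->
  e <= Rabs (rho x b - rho x b').
Proof.
  intros [_ Hb] [_ Hb'] Hne.
  destruct (le_min (fun z => z = b \/ z = b')) as [m [[-> | ->] Hm]]; [exists b; auto | |].
  - specialize (Hb' b (Hm _ (or_intror eq_refl)) Hne).
    unfold Rabs; destruct Rcase_abs; lra.
  - specialize (Hb b' (Hm _ (or_introl eq_refl)) (not_eq_sym Hne)).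
    unfold Rabs; destruct Rcase_abs; lra.
Qed.

(** At depth [e] the distances [rho x b] are [e]-separated and below [1], so each interval from
    [n e] to [(n + 1) e] contributes at most one point. *)
Lemma depth_finite x e : 0 < e -> exists L, forall b, In b L <-> depth_at_least b x e.
Proof.
  intros He.
  assert (Hn : forall n : nat, exists L, forall b, In b L <->
             depth_at_least b x e /\ rho x b < INR n * e).
  { induction n as [|n [L HL]].
    - exists nil; intros b; split; [intros []|]; intros [_ Hb].
      pose proof (rho_pos x b); simpl in Hb; lra.
    - destruct (classic (exists b0, depth_at_least b0 x e /\ INR n * e <= rho x b0 < INR (S n) * e))
        as [[b0 [Hb0 Hr0]] | Hno].
      + exists (b0 :: L); intros b; split.
        * intros [<- | Hb]; [tauto|].
          apply HL in Hb; split; [tauto|]; rewrite S_INR; lra.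
        * intros [Hb Hr]; destruct (Rlt_le_dec (rho x b) (INR n * e)) as [Hlt | Hle].
          -- right; apply HL; tauto.
          -- left; apply NNPP; intros Hne.
             pose proof (depth_separated _ _ _ _ Hb0 Hb Hne) as Hs.
             rewrite S_INR in *; revert Hs; unfold Rabs; destruct Rcase_abs; lra.
      + exists L; intros b; split.
        * intros Hb; apply HL in Hb; split; [tauto|]; rewrite S_INR; lra.
        * intros [Hb Hr]; apply HL; split; [assumption|].
          destruct (Rlt_le_dec (rho x b) (INR n * e)); [assumption|].
          elim Hno; exists b; auto. }
  destruct (INR_unbounded (1 / e)) as [n Hgt].
  destruct (Hn n) as [L HL]; exists L; intros b; rewrite HL; split; [tauto|].
  intros Hb; split; [assumption|]; destruct Hb as [Hb _].
  assert (1 / e * e < INR n * e) by (apply Rmult_lt_compat_r; lra).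
  replace (1 / e * e) with 1 in * by (field; lra); lra.
Qed.

(** The supremum of the depths need not be attained; the first power of [1 / 2] that occurs as a
    depth is more than half of every other one. *)
Lemma nearly_deepest x : exists b e, 0 < e /\ depth_at_least b x e /\
  forall b' e', depth_at_least b' x e' -> e' < 2 * e.
Proof.
  destruct (least_nat (fun n => exists b, depth_at_least b x ((1 / 2) ^ n))) as [n [[b Hb] Hmin]].
  - destruct (depth_exists x) as [b [e [He Hb]]].
    destruct (pow_lt_1_zero (1 / 2)) with (y := e) as [n Hn];
      [rewrite Rabs_pos_eq; lra | lra |].
    exists n, b; apply depth_anti with e; [assumption|].
    specialize (Hn n (Nat.le_refl n)).
    rewrite Rabs_pos_eq in Hn; [lra | left; apply pow_lt; lra].
  - exists b, ((1 / 2) ^ n); split; [apply pow_lt; lra|]; split; [assumption|].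
    intros b' e' Hb'; apply Rnot_le_lt; intros Hle.
    destruct n as [|n].
    + destruct Hb' as [Hb' _]; pose proof (rho_pos x b'); simpl in Hle; lra.
    + apply (Hmin n); [lia|]; exists b'; apply depth_anti with e'; [assumption|].
      simpl in Hle; lra.
Qed.

Lemma locally_finite_choice_wo : exists a : E -> E,
  forall p, exists r, 0 < r /\ exists L : list E,
    (forall b, In b L -> rho p b < 1) /\ forall y, rho p y < r -> In (a y) L.
Proof.
  destruct (choice _ nearly_deepest) as [a Ha].
  exists a; intros p; destruct (Ha p) as [e [He [Hp _]]].
  exists (e / 12); split; [lra|].
  destruct (depth_finite p (e / 4)) as [L HL]; [lra|].
  exists L; split.
  - intros b Hb; apply HL in Hb; destruct Hb as [Hb _]; lra.
  - intros y Hy; apply HL; destruct (Ha y) as [e' [He' [Hy' Hmax]]].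
    (* Depth [e] at [p] leaves [5e/6] at [y], so [e'] exceeds [5e/12]; moving [a y] back to [p]
       costs [e/6] and leaves more than [e/4]. *)
    apply depth_move with (y := y) (r := e / 12) in Hp; [|lra].
    specialize (Hmax _ _ Hp).
    apply depth_move with (y := p) (r := e / 12) in Hy'; [|rewrite rho_sym; lra].
    apply depth_anti with (e' - 2 * (e / 12)); [assumption|lra].
Qed.

End Selection.

Lemma locally_finite_choice {E : Type} (rho : E -> E -> R) :
  (forall x y, 0 <= rho x y) -> (forall x, rho x x = 0) ->
  (forall x y, rho x y = rho y x) -> (forall x y z, rho x z <= rho x y + rho y z) ->
  exists a : E -> E,
  forall p, exists r, 0 < r /\ exists L : list E,
    (forall b, In b L -> rho p b < 1) /\ forall y, rho p y < r -> In (a y) L.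
Proof.
  intros; destruct (well_ordered_type E) as [le [Hanti Hmin]].
  eapply locally_finite_choice_wo; eassumption.
Qed.

(* With [Q x r] saying that the ball of radius [r] around [x] is contained in a member of a
   cover, [l] is a Lebesgue number that depends on the point. *)
Lemma lebesgue_function {E : Type} (d : E -> E -> R) (X : E -> Prop) (Q : E -> R -> Prop) :
  (forall x, d x x = 0) -> (forall x y, 0 <= d x y) -> (forall x y, d x y = d y x) ->
  (forall x y r r', X x -> X y -> Q x r -> 0 < r' -> d x y + r' <= r -> Q y r') ->
  (forall x, X x -> exists r, 0 < r /\ Q x r) ->
  exists l : E -> R, (forall x, X x -> 0 < l x <= 1 /\ Q x (l x)) /\
    forall x y, X x -> X y -> Rabs (l x - l y) <= d x y.
Proof.
  intros Hrefl Hpos Hsym Hher Hex.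
  (* The supremum of the admissible radii, capped at [1]; outside [X] the value is a dummy. *)
  assert (Hsup : forall x, exists s, X x ->
            is_lub (fun r => 0 < r <= 1 /\ Q x r) s).
  { intros x; destruct (classic (X x)) as [Xx | nX]; [|exists 0; tauto].
    destruct (completeness (fun r => 0 < r <= 1 /\ Q x r)) as [s Hs].
    - exists 1; intros r [[_ Hr] _]; assumption.
    - destruct (Hex x Xx) as [r [Hr HQ]].
      exists (Rmin r 1); pose proof (Rmin_l r 1); pose proof (Rmin_r r 1).
      assert (0 < Rmin r 1) by (apply Rmin_glb_lt; lra).
      split; [lra|]; apply (Hher x x r); auto; rewrite Hrefl; lra.
    - exists s; auto. }
  destruct (choice _ Hsup) as [s Hs]; clear Hsup.
  assert (Hspos : forall x, X x -> 0 < s x <= 1).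
  { intros x Xx; destruct (Hs x Xx) as [Hub Hlub]; split.
    - destruct (Hex x Xx) as [r [Hr HQ]].
      pose proof (Rmin_l r 1); pose proof (Rmin_r r 1).
      assert (0 < Rmin r 1) by (apply Rmin_glb_lt; lra).
      apply Rlt_le_trans with (Rmin r 1); [assumption|]; apply Hub; split; [lra|].
      apply (Hher x x r); auto; rewrite Hrefl; lra.
    - apply Hlub; intros r [[_ Hr] _]; assumption. }
  assert (Hin : forall x r, X x -> 0 < r < s x -> Q x r).
  { intros x r Xx Hr; destruct (Hs x Xx) as [_ Hlub].
    destruct (classic (exists r', r < r' /\ 0 < r' <= 1 /\ Q x r')) as [[r' [Hrr [Hr' HQ]]] | Hno].
    - apply (Hher x x r'); auto; [lra|]; rewrite Hrefl; lra.
    - assert (s x <= r); [|lra].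
      apply Hlub; intros r' Hr'; apply Rnot_lt_le; intros Hlt; apply Hno; exists r'; tauto. }
  assert (Hlip : forall x y, X x -> X y -> s x <= s y + d x y).
  { intros x y Xx Xy; apply Rnot_lt_le; intros Hlt.
    pose proof (Hpos x y); pose proof (Hspos y Xy); pose proof (Hspos x Xx).
    destruct (Hs y Xy) as [Hub _].
    pose (r := (s x + (s y + d x y)) / 2).
    assert (Hr : s y + d x y < r < s x) by (unfold r; lra).
    assert (r - d x y <= s y); [|lra].
    apply Hub; split; [lra|].
    apply (Hher x y r); auto; [apply Hin; auto; lra | lra | lra]. }
  (* Half the supremum, because the supremum itself need not be admissible. *)
  exists (fun x => s x / 2); split.
  - intros x Xx; pose proof (Hspos x Xx); split; [lra|]; apply Hin; auto; lra.
  - intros x y Xx Xy; pose proof (Hlip x y Xx Xy); pose proof (Hlip y x Xy Xx).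
    rewrite (Hsym y x) in *; pose proof (Hpos x y).
    unfold Rabs; destruct Rcase_abs; lra.
Qed.

(** * Deciding identities between linear combinations *)

Inductive vexpr : Type :=
| VZero : vexpr
| VVar : nat -> vexpr
| VAdd : vexpr -> vexpr -> vexpr
| VOpp : vexpr -> vexpr
| VScale : R -> vexpr -> vexpr.

Fixpoint vcoef (e : vexpr) (i : nat) : R :=
  match e with
  | VZero => 0
  | VVar n => if Nat.eqb n i then 1 else 0
  | VAdd a b => vcoef a i + vcoef b i
  | VOpp a => - vcoef a i
  | VScale r a => r * vcoef a i
  end.

(** Recursion on the length lets [simpl] produce one real equation per atom. *)
Fixpoint agree (n : nat) (c c' : nat -> R) : Prop :=
  match n with
  | O => True
  | S n => c O = c' O /\ agree n (fun i => c (S i)) (fun i => c' (S i))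
  end.

Section VectorIdentities.
Context {E : Type} (V : RVectorSpace E).

Lemma vzero_add x : vadd V (vzero V) x = x.
Proof. rewrite vadd_comm; apply vadd_zero. Qed.

Lemma vadd_cancel x y : vadd V x y = x -> y = vzero V.
Proof.
  intros H; rewrite <- (vadd_opp E V x); rewrite <- H at 1.
  rewrite (vadd_comm _ V x y), <- vadd_assoc, vadd_opp, vadd_zero; reflexivity.
Qed.

Lemma vscale_0_l x : vscale V 0 x = vzero V.
Proof.
  apply vadd_cancel with (vscale V 0 x); rewrite <- vscale_distr_s; f_equal; ring.
Qed.

Lemma vscale_0_r a : vscale V a (vzero V) = vzero V.
Proof.
  apply vadd_cancel with (vscale V a (vzero V)).
  rewrite <- vscale_distr_v, vadd_zero; reflexivity.
Qed.

Lemma vopp_scale x : vopp V x = vscale V (-1) x.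
Proof.
  rewrite <- (vzero_add (vscale V (-1) x)), <- (vadd_opp E V x), (vadd_comm E V x).
  rewrite <- vadd_assoc; rewrite <- (vscale_one E V x) at 3.
  rewrite <- vscale_distr_s; replace (1 + -1) with 0 by ring.
  rewrite vscale_0_l, vadd_zero; reflexivity.
Qed.

Lemma vadd_swap a b c e :
  vadd V (vadd V a b) (vadd V c e) = vadd V (vadd V a c) (vadd V b e).
Proof.
  rewrite <- !vadd_assoc; f_equal.
  rewrite !vadd_assoc; f_equal; apply vadd_comm.
Qed.

Fixpoint vsum (c : nat -> R) (env : list E) : E :=
  match env with
  | nil => vzero V
  | v :: l => vadd V (vscale V (c O) v) (vsum (fun i => c (S i)) l)
  end.

Fixpoint veval (env : list E) (e : vexpr) : E :=
  match e with
  | VZero => vzero V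
  | VVar n => nth n env (vzero V)
  | VAdd a b => vadd V (veval env a) (veval env b)
  | VOpp a => vopp V (veval env a)
  | VScale r a => vscale V r (veval env a)
  end.

Lemma vsum_agree env : forall c c', agree (length env) c c' -> vsum c env = vsum c' env.
Proof.
  induction env as [|v l IH]; intros c c' H; simpl; [reflexivity|].
  destruct H as [-> H]; f_equal; apply IH, H.
Qed.

Lemma vsum_zero env : vsum (fun _ => 0) env = vzero V.
Proof.
  induction env as [|v l IH]; simpl; [reflexivity|].
  rewrite IH, vscale_0_l, vadd_zero; reflexivity.
Qed.

Lemma vsum_add env : forall c c',
  vsum (fun i => c i + c' i) env = vadd V (vsum c env) (vsum c' env).
Proof.
  induction env as [|v l IH]; intros c c'; simpl; [symmetry; apply vadd_zero|].
  rewrite vscale_distr_s, (IH (fun i => c (S i)) (fun i => c' (S i))); apply vadd_swap.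
Qed.

Lemma vsum_scale env : forall r c, vsum (fun i => r * c i) env = vscale V r (vsum c env).
Proof.
  induction env as [|v l IH]; intros r c; simpl; [symmetry; apply vscale_0_r|].
  rewrite vscale_distr_v, vscale_assoc, (IH r (fun i => c (S i))); reflexivity.
Qed.

Lemma vsum_var env : forall n,
  vsum (fun i => if Nat.eqb n i then 1 else 0) env = nth n env (vzero V).
Proof.
  induction env as [|v l IH]; intros [|n]; simpl; try reflexivity.
  - rewrite vscale_one, vsum_zero, vadd_zero; reflexivity.
  - rewrite vscale_0_l, vzero_add; apply IH.
Qed.

Lemma veval_vsum env e : veval env e = vsum (vcoef e) env.
Proof.
  induction e as [|n|a IHa b IHb|a IHa|r a IHa]; simpl.
  - symmetry; apply vsum_zero.
  - symmetry; apply (vsum_var env n).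
  - rewrite IHa, IHb; symmetry; apply vsum_add.
  - rewrite IHa, vopp_scale, <- vsum_scale.
    f_equal; apply FunctionalExtensionality.functional_extensionality; intros; ring.
  - rewrite IHa; symmetry; apply vsum_scale.
Qed.

(** The reflection principle behind [vec]: each side is the sum of the atoms weighted by its
    coefficients. *)
Lemma veval_eq env e e' :
  agree (length env) (vcoef e) (vcoef e') -> veval env e = veval env e'.
Proof. intros H; rewrite !veval_vsum; apply vsum_agree, H. Qed.

End VectorIdentities.

Ltac vec_mem x l :=
  lazymatch l with
  | nil => constr:(false)
  | x :: _ => constr:(true)
  | _ :: ?l => vec_mem x l
  end.

Ltac vec_index x l :=
  lazymatch l with
  | x :: _ => constr:(O)
  | _ :: ?l => let n := vec_index x l in constr:(S n)
  end.

Ltac vec_atoms t l :=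
  lazymatch t with
  | vzero _ => l
  | vadd _ ?a ?b => let l := vec_atoms a l in vec_atoms b l
  | vopp _ ?a => vec_atoms a l
  | vscale _ _ ?a => vec_atoms a l
  | _ => lazymatch vec_mem t l with true => l | false => constr:(t :: l) end
  end.

Ltac vec_reify t l :=
  lazymatch t with
  | vzero _ => constr:(VZero)
  | vadd _ ?a ?b => let a := vec_reify a l in let b := vec_reify b l in constr:(VAdd a b)
  | vopp _ ?a => let a := vec_reify a l in constr:(VOpp a)
  | vscale _ ?r ?a => let a := vec_reify a l in constr:(VScale r a)
  | _ => let n := vec_index t l in constr:(VVar n)
  end.

Ltac vec_coefs :=
  lazymatch goal with
  | |- @eq ?E ?u ?v =>
      lazymatch goal with
      | V : RVectorSpace E |- _ =>
          let l := vec_atoms u (@nil E) in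
          let l := vec_atoms v l in
          let e := vec_reify u l in
          let e' := vec_reify v l in
          apply (veval_eq V l e e'); simpl; repeat split
      end
  end.

Ltac vec := vec_coefs; field; repeat split; try lra.

(** * Seminorms *)

Section Seminorms.
Context {E : Type} (V : RVectorSpace E).

Definition vsub (x y : E) : E := vadd V x (vopp V y).

Definition seminorm (q : E -> R) : Prop :=
  (forall x y, q (vadd V x y) <= q x + q y) /\
  (forall a x, q (vscale V a x) = Rabs a * q x).

Lemma seminorm_zero q : seminorm q -> q (vzero V) = 0.
Proof.
  intros [_ Hs]; rewrite <- (vscale_0_l V (vzero V)), Hs, Rabs_R0; ring.
Qed.

Lemma seminorm_opp q x : seminorm q -> q (vopp V x) = q x.
Proof.
  intros [_ Hs]; rewrite vopp_scale, Hs, Rabs_left by lra; ring.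
Qed.

Lemma seminorm_sub_comm q x y : seminorm q -> q (vsub x y) = q (vsub y x).
Proof.
  intros Hq; rewrite <- (seminorm_opp q (vsub x y) Hq); f_equal; unfold vsub; vec.
Qed.

Lemma seminorm_pos q x : seminorm q -> 0 <= q x.
Proof.
  intros Hq; pose proof (proj1 Hq x (vopp V x)) as H.
  rewrite vadd_opp, (seminorm_zero q Hq), (seminorm_opp q x Hq) in H; lra.
Qed.

Lemma seminorm_sub_le q x y : seminorm q -> q (vsub x y) <= q x + q y.
Proof.
  intros Hq; unfold vsub; rewrite <- (seminorm_opp q y Hq); apply (proj1 Hq).
Qed.

Lemma seminorm_tri q x y z : seminorm q -> q (vsub x z) <= q (vsub x y) + q (vsub y z).
Proof.
  intros Hq; replace (vsub x z) with (vadd V (vsub x y) (vsub y z)); [apply (proj1 Hq)|].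
  unfold vsub; vec.
Qed.

Definition subspace (F : E -> Prop) : Prop :=
  F (vzero V) /\ (forall x y, F x -> F y -> F (vadd V x y)) /\
  (forall a x, F x -> F (vscale V a x)).

(** Take for [P] the [q]-distance to [F]. *)
Lemma quotient_seminorm (q : E -> R) (F : E -> Prop) :
  seminorm q -> subspace F ->
  exists P : E -> R, seminorm P /\ (forall x f, F f -> P x <= q (vsub x f)) /\
    (forall x r, P x < r -> exists f, F f /\ q (vsub x f) < r).
Proof.
  intros Hq [HF0 [HFa HFs]].
  assert (Hex : forall x, exists m, (forall f, F f -> m <= q (vsub x f)) /\
            forall r, m < r -> exists f, F f /\ q (vsub x f) < r).
  { intros x; destruct (infimum_exists (fun r => exists f, F f /\ r = q (vsub x f)))
      as [m [Hlb Happ]].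
    - eexists; exists (vzero V); split; [assumption | reflexivity].
    - intros r [f [_ ->]]; apply seminorm_pos, Hq.
    - exists m; split.
      + intros f Hf; apply Hlb; exists f; auto.
      + intros r Hr; destruct (Happ (r - m)) as [s [[f [Hf ->]] Hlt]]; [lra|].
        exists f; split; [assumption|lra]. }
  destruct (choice _ Hex) as [P HP].
  exists P; split; [|split; intros x; [intros; now apply HP | apply HP]].
  (* For nonzero [a] the reverse inequality follows from this one, applied to [/ a] and
     [vscale V a x]. *)
  assert (Hle : forall a x, P (vscale V a x) <= Rabs a * P x).
  { intros a x; apply Rnot_lt_le; intros Hlt.
    destruct (Req_dec a 0) as [-> | Ha].
    - rewrite Rabs_R0, Rmult_0_l, vscale_0_l in Hlt.
      pose proof (proj1 (HP (vzero V)) _ HF0) as H.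
      replace (vsub (vzero V) (vzero V)) with (vzero V) in H by (unfold vsub; vec_coefs).
      rewrite (seminorm_zero q Hq) in H; lra.
    - pose proof (Rabs_pos_lt a Ha) as Hpos.
      destruct (proj2 (HP x) (P (vscale V a x) / Rabs a)) as [f [Hf Hr]].
      { apply Rmult_lt_reg_l with (Rabs a); [assumption|].
        replace (Rabs a * (P (vscale V a x) / Rabs a)) with (P (vscale V a x)) by (field; lra).
        assumption. }
      pose proof (proj1 (HP (vscale V a x)) _ (HFs a f Hf)) as H.
      replace (vsub (vscale V a x) (vscale V a f)) with (vscale V a (vsub x f)) in H
        by (unfold vsub; vec).
      rewrite (proj2 Hq) in H.
      apply Rmult_lt_compat_l with (r := Rabs a) in Hr; [|assumption].
      replace (Rabs a * (P (vscale V a x) / Rabs a)) with (P (vscale V a x)) in Hr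
        by (field; lra).
      lra. }
  split.
  - intros x y; apply Rnot_lt_le; intros Hlt.
    pose (e := (P (vadd V x y) - (P x + P y)) / 2).
    destruct (proj2 (HP x) (P x + e)) as [f [Hf Hrf]]; [unfold e; lra|].
    destruct (proj2 (HP y) (P y + e)) as [g [Hg Hrg]]; [unfold e; lra|].
    pose proof (proj1 (HP (vadd V x y)) _ (HFa f g Hf Hg)) as H.
    replace (vsub (vadd V x y) (vadd V f g)) with (vadd V (vsub x f) (vsub y g)) in H
      by (unfold vsub; vec).
    pose proof (proj1 Hq (vsub x f) (vsub y g)); unfold e in *; lra.
  - intros a x; apply Rle_antisym; [apply Hle|].
    destruct (Req_dec a 0) as [-> | Ha].
    + rewrite Rabs_R0, Rmult_0_l; apply Rnot_lt_le; intros Hlt.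
      destruct (proj2 (HP _) _ Hlt) as [f [_ H]].
      pose proof (seminorm_pos q (vsub (vscale V 0 x) f) Hq); lra.
    + pose proof (Hle (/ a) (vscale V a x)) as H.
      replace (vscale V (/ a) (vscale V a x)) with x in H by (vec; assumption).
      pose proof (Rabs_pos_lt a Ha) as Hpos.
      rewrite Rabs_inv in H.
      apply Rmult_le_compat_l with (r := Rabs a) in H; [|lra].
      replace (Rabs a * (/ Rabs a * P (vscale V a x))) with (P (vscale V a x)) in H
        by (field; lra).
      assumption.
Qed.

Definition symmetric_absorbing_convex (C : E -> Prop) : Prop :=
  convex V C /\ (forall x, C x -> C (vopp V x)) /\
  forall x, exists r, 0 < r /\ C (vscale V (/ r) x).

(** The gauge of [C]: the infimum of the positive [r] with [x / r] in [C]. *)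
Lemma minkowski_functional (C : E -> Prop) : symmetric_absorbing_convex C ->
  exists q, seminorm q /\ (forall x, q x < 1 -> C x) /\
    forall x r, 0 < r -> C (vscale V (/ r) x) -> q x <= r.
Proof.
  intros [Hconv [Hsym Habs]].
  assert (Hex : forall x, exists m, (forall r, 0 < r -> C (vscale V (/ r) x) -> m <= r) /\
            forall s, m < s -> exists r, 0 < r < s /\ C (vscale V (/ r) x)).
  { intros x; destruct (infimum_exists (fun r => 0 < r /\ C (vscale V (/ r) x)))
      as [m [Hlb Happ]]; [apply Habs | intros r [Hr _]; lra |].
    exists m; split; [intros; apply Hlb; auto|].
    intros s Hs; destruct (Happ (s - m)) as [r [[Hr HC] Hlt]]; [lra|].
    exists r; split; [lra | assumption]. }
  destruct (choice _ Hex) as [q Hq].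
  assert (HC0 : C (vzero V)).
  { destruct (Habs (vzero V)) as [r [_ H]]; now rewrite vscale_0_r in H. }
  assert (Hnn : forall x, 0 <= q x).
  { intros x; apply Rnot_lt_le; intros Hlt.
    destruct (proj2 (Hq x) _ Hlt) as [r [Hr _]]; lra. }
  assert (Hle : forall a x, q (vscale V a x) <= Rabs a * q x).
  { intros a x; apply Rnot_lt_le; intros Hlt.
    destruct (Req_dec a 0) as [-> | Ha].
    - rewrite Rabs_R0, Rmult_0_l, vscale_0_l in Hlt.
      assert (q (vzero V) <= q (vzero V) / 2); [|lra].
      apply Hq; [lra|]; now rewrite vscale_0_r.
    - pose proof (Rabs_pos_lt a Ha) as Hpos.
      destruct (proj2 (Hq x) (q (vscale V a x) / Rabs a)) as [r [Hr HC]].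
      { apply Rmult_lt_reg_l with (Rabs a); [assumption|].
        replace (Rabs a * (q (vscale V a x) / Rabs a)) with (q (vscale V a x)) by (field; lra).
        assumption. }
      assert (q (vscale V a x) <= Rabs a * r).
      { apply Hq; [apply Rmult_lt_0_compat; lra|].
        unfold Rabs in *; destruct Rcase_abs.
        - replace (vscale V (/ (- a * r)) (vscale V a x)) with (vopp V (vscale V (/ r) x))
            by vec; auto.
        - replace (vscale V (/ (a * r)) (vscale V a x)) with (vscale V (/ r) x)
            by vec; auto. }
      destruct Hr as [_ Hr]; apply Rmult_lt_compat_l with (r := Rabs a) in Hr; [|assumption].
      replace (Rabs a * (q (vscale V a x) / Rabs a)) with (q (vscale V a x)) in Hr
        by (field; lra).
      lra. }
  exists q; split; [split|split].
  - intros x y; apply Rnot_lt_le; intros Hlt.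
    pose (e := (q (vadd V x y) - (q x + q y)) / 2).
    destruct (proj2 (Hq x) (q x + e)) as [r [Hr HCr]]; [unfold e; lra|].
    destruct (proj2 (Hq y) (q y + e)) as [s [Hs HCs]]; [unfold e; lra|].
    assert (q (vadd V x y) <= r + s); [|unfold e in *; lra].
    apply Hq; [lra|].
    (* [(x + y) / (r + s)] is a convex combination of [x / r] and [y / s]. *)
    replace (vscale V (/ (r + s)) (vadd V x y)) with
      (vadd V (vscale V (r / (r + s)) (vscale V (/ r) x))
              (vscale V (1 - r / (r + s)) (vscale V (/ s) y))) by vec.
    apply Hconv; trivial; split.
    + apply Rle_mult_inv_pos; lra.
    + apply Rmult_le_reg_r with (r + s); [lra|].
      replace (r / (r + s) * (r + s)) with r by (field; lra); lra.
  - intros a x; apply Rle_antisym; [apply Hle|].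
    destruct (Req_dec a 0) as [-> | Ha].
    + rewrite Rabs_R0, Rmult_0_l; apply Hnn.
    + pose proof (Hle (/ a) (vscale V a x)) as H.
      replace (vscale V (/ a) (vscale V a x)) with x in H by (vec; assumption).
      pose proof (Rabs_pos_lt a Ha) as Hpos.
      rewrite Rabs_inv in H.
      apply Rmult_le_compat_l with (r := Rabs a) in H; [|lra].
      replace (Rabs a * (/ Rabs a * q (vscale V a x))) with (q (vscale V a x)) in H
        by (field; lra).
      assumption.
  - intros x Hx; destruct (proj2 (Hq x) _ Hx) as [r [Hr HC]].
    replace x with (vadd V (vscale V r (vscale V (/ r) x)) (vscale V (1 - r) (vzero V))) by vec.
    apply Hconv; trivial; lra.
  - intros x r; apply Hq.
Qed.

End Seminorms.

(** * Far away bounded sequences in non-separable sets *)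

Fixpoint lspan {E : Type} (V : RVectorSpace E) (l : list E) (x : E) : Prop :=
  match l with
  | nil => x = vzero V
  | v :: l => exists a y, lspan V l y /\ x = vadd V y (vscale V a v)
  end.

(** Separability at a single scale. The centres may lie outside [A], so that subsets inherit
    smallness. *)
Definition small {E : Type} (V : RVectorSpace E) (q : E -> R) (A : E -> Prop) : Prop :=
  exists s : nat -> E, forall x, A x -> exists n, q (vsub V x (s n)) < 1.

Section SmallSets.
Context {E : Type} (V : RVectorSpace E) (q : E -> R) (Hq : seminorm V q).

Lemma lspan_subspace l : subspace V (lspan V l).
Proof.
  induction l as [|v l [IH0 [IHa IHs]]]; (split; [|split]); simpl.
  - reflexivity.
  - intros x y -> ->; apply vadd_zero.
  - intros a x ->; apply vscale_0_r.
  - exists 0, (vzero V); split; [assumption|]; vec.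
  - intros x y [a [x' [Hx ->]]] [b [y' [Hy ->]]].
    exists (a + b), (vadd V x' y'); split; [auto|]; vec.
  - intros c x [a [x' [Hx ->]]].
    exists (c * a), (vscale V c x'); split; [auto|]; vec.
Qed.

Lemma small_subset (A B : E -> Prop) : (forall x, A x -> B x) -> small V q B -> small V q A.
Proof. intros HAB [s Hs]; exists s; auto. Qed.

Lemma small_countable_union (A : nat -> E -> Prop) :
  (forall n, small V q (A n)) -> small V q (fun x => exists n, A n x).
Proof.
  intros H; destruct (choice _ H) as [s Hs].
  exists (fun k => let (n, i) := of_nat k in s n i).
  intros x [n Hx]; destruct (Hs n x Hx) as [i Hi].
  exists (to_nat (n, i)); rewrite cancel_of_to; exact Hi.
Qed.

(** Integers are written as differences of naturals so that the grid can be enumerated by [nat]. *)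
Lemma grid_approximation (h c : R) : 0 < h ->
  exists i j : nat, Rabs (c - h * (INR i - INR j)) <= h.
Proof.
  intros Hh; destruct (archimed (c / h)) as [H1 H2].
  exists (Z.to_nat (up (c / h))), (Z.to_nat (- up (c / h))).
  replace (INR (Z.to_nat (up (c / h))) - INR (Z.to_nat (- up (c / h)))) with (IZR (up (c / h))).
  - replace (c - h * IZR (up (c / h))) with (h * (c / h - IZR (up (c / h)))) by (field; lra).
    rewrite Rabs_mult, (Rabs_pos_eq h) by lra.
    apply Rle_trans with (h * 1); [apply Rmult_le_compat_l; [lra|] | lra].
    unfold Rabs; destruct Rcase_abs; lra.
  - rewrite !INR_IZR_INZ, <- minus_IZR; f_equal; lia.
Qed.

Lemma lspan_separable l : forall e, 0 < e ->
  exists s : nat -> E, forall x, lspan V l x -> exists n, q (vsub V x (s n)) < e.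
Proof.
  induction l as [|v l IH]; intros e He.
  - exists (fun _ => vzero V); intros x ->; exists O.
    replace (vsub V (vzero V) (vzero V)) with (vzero V) by (unfold vsub; vec_coefs).
    rewrite (seminorm_zero V q Hq); assumption.
  - destruct (IH (e / 2)) as [s Hs]; [lra|].
    pose proof (seminorm_pos V q v Hq) as Hv.
    (* With this mesh, rounding the coefficient of [v] costs at most [e / 4]; the [+ 1] avoids a
       zero denominator. *)
    pose (h := e / (4 * (q v + 1))).
    assert (Hh : 0 < h) by (apply Rdiv_lt_0_compat; lra).
    assert (Hhv : h * q v <= e / 4).
    { unfold h; apply Rmult_le_reg_r with (4 * (q v + 1)); [lra|].
      replace (e / (4 * (q v + 1)) * q v * (4 * (q v + 1))) with (e * q v) by (field; lra).
      replace (e / 4 * (4 * (q v + 1))) with (e * q v + e) by field; lra. }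
    exists (fun k => let (n, k) := of_nat k in let (i, j) := of_nat k in
              vadd V (s n) (vscale V (h * (INR i - INR j)) v)).
    intros x [a [y [Hy ->]]].
    destruct (Hs y Hy) as [n Hn].
    destruct (grid_approximation h a Hh) as [i [j Hij]].
    exists (to_nat (n, to_nat (i, j))); rewrite !cancel_of_to.
    replace (vsub V (vadd V y (vscale V a v)) (vadd V (s n) (vscale V (h * (INR i - INR j)) v)))
      with (vadd V (vsub V y (s n)) (vscale V (a - h * (INR i - INR j)) v))
      by (unfold vsub; vec).
    pose proof (proj1 Hq (vsub V y (s n)) (vscale V (a - h * (INR i - INR j)) v)) as Ht.
    rewrite (proj2 Hq) in Ht.
    pose proof (Rmult_le_compat_r _ _ _ Hv Hij); lra.
Qed.

(** Otherwise [A] is within [1 / 2] of the span, which is within [1 / 2] of a countable set, and [A]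
    would be small. *)
Lemma far_from_lspan A l : ~ small V q A ->
  exists z, A z /\ forall f, lspan V l f -> 1 / 2 <= q (vsub V z f).
Proof.
  intros HA; apply NNPP; intros Hno; apply HA.
  destruct (lspan_separable l (1 / 2)) as [s Hs]; [lra|].
  exists s; intros x Ax.
  assert (Hf : exists f, lspan V l f /\ q (vsub V x f) < 1 / 2).
  { apply NNPP; intros Hf; apply Hno; exists x; split; [assumption|].
    intros f Hlf; apply Rnot_lt_le; intros Hlt; apply Hf; exists f; auto. }
  destruct Hf as [f [Hlf Hf]]; destruct (Hs f Hlf) as [n Hn]; exists n.
  pose proof (seminorm_tri V q x f (s n) Hq); lra.
Qed.

End SmallSets.

(** * The metric, continuous seminorms and bounded sequences *)

Section Metric.
Context {E : Type} (V : RVectorSpace E) (d : E -> E -> R) (HF : frechet_space V d).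

(** By translation invariance this F-norm determines [d]; it need not be homogeneous, so scaling is
    handled through continuity. *)
Definition fnorm (x : E) : R := d (vzero V) x.

Lemma dist_refl x : d x x = 0.
Proof. destruct HF as [[_ [H _]] _]; now apply H. Qed.

Lemma dist_pos x y : 0 <= d x y.
Proof. destruct HF as [[H _] _]; apply H. Qed.

Lemma dist_sym x y : d x y = d y x.
Proof. destruct HF as [[_ [_ [H _]]] _]; apply H. Qed.

Lemma dist_tri x y z : d x z <= d x y + d y z.
Proof. destruct HF as [[_ [_ [_ H]]] _]; apply H. Qed.

Lemma dist_fnorm x y : d x y = fnorm (vsub V y x).
Proof.
  destruct HF as [_ [Hinv _]]; unfold fnorm.
  rewrite <- (Hinv (vzero V) (vsub V y x) x); f_equal; unfold vsub; vec.
Qed.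

Lemma fnorm_opp x : fnorm (vopp V x) = fnorm x.
Proof.
  replace (vopp V x) with (vsub V (vzero V) x) by (unfold vsub; vec).
  rewrite <- dist_fnorm, dist_sym; reflexivity.
Qed.

Lemma fnorm_add x y : fnorm (vadd V x y) <= fnorm x + fnorm y.
Proof.
  unfold fnorm at 1; pose proof (dist_tri (vzero V) x (vadd V x y)) as H.
  rewrite (dist_fnorm x) in H.
  replace (vsub V (vadd V x y) x) with y in H by (unfold vsub; vec); exact H.
Qed.

Lemma scale_continuous a x e : 0 < e -> exists r, 0 < r /\
  forall b y, Rabs (a - b) < r -> d x y < r -> d (vscale V a x) (vscale V b y) < e.
Proof. destruct HF as [_ [_ [_ [H _]]]]; apply H. Qed.

Lemma scale_absorbing x e : 0 < e -> exists r, 0 < r /\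
  forall a, Rabs a <= r -> fnorm (vscale V a x) < e.
Proof.
  intros He; destruct (scale_continuous 0 x e He) as [r [Hr H]].
  exists (r / 2); split; [lra|]; intros a Ha.
  unfold fnorm; rewrite <- (vscale_0_l V x) at 1; apply H.
  - rewrite Rminus_0_l, Rabs_Ropp; lra.
  - rewrite dist_refl; lra.
Qed.

Definition seminorm_continuous (q : E -> R) : Prop :=
  forall e, 0 < e -> exists r, 0 < r /\ forall x, fnorm x < r -> q x < e.

(** Take the gauge of the intersection of a convex neighbourhood [C] of zero with its reflection.
    This set contains a metric ball, which makes the gauge continuous. *)
Lemma seminorm_below e : 0 < e -> exists q,
  seminorm V q /\ seminorm_continuous q /\ forall x, q x < 1 -> fnorm x < e.
Proof.
  intros He; destruct HF as [_ [_ [_ [_ [Hlc _]]]]].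
  destruct (Hlc e He) as [C [Hconv [Hopen [HC0 HCe]]]].
  destruct (Hopen _ HC0) as [r [Hr HrC]].
  pose (C' := fun x => C x /\ C (vopp V x)).
  assert (HC' : forall x, fnorm x < r -> C' x).
  { intros x Hx; split; apply HrC; [exact Hx|]; fold (fnorm (vopp V x)).
    rewrite fnorm_opp; exact Hx. }
  destruct (minkowski_functional V C') as [q [Hq [Hq1 Hqr]]].
  - split; [|split].
    + intros x y t [Cx Cx'] [Cy Cy'] Ht; split; [now apply Hconv|].
      replace (vopp V (vadd V (vscale V t x) (vscale V (1 - t) y))) with
        (vadd V (vscale V t (vopp V x)) (vscale V (1 - t) (vopp V y))) by vec.
      now apply Hconv.
    + intros x [Cx Cx']; split; [assumption|].
      now replace (vopp V (vopp V x)) with x by vec.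
    + intros x; destruct (scale_absorbing x r Hr) as [s [Hs Hsx]].
      exists (/ s); split; [now apply Rinv_0_lt_compat|].
      rewrite Rinv_inv; apply HC', Hsx; rewrite Rabs_pos_eq; lra.
  - exists q; split; [assumption|]; split.
    + intros eta Heta.
      destruct (scale_continuous (/ (eta / 2)) (vzero V) r Hr) as [s [Hs Hsx]].
      exists s; split; [assumption|]; intros x Hx.
      apply Rle_lt_trans with (eta / 2); [|lra].
      apply Hqr; [lra|]; apply HC'; unfold fnorm.
      rewrite <- (vscale_0_r V (/ (eta / 2))) at 1; apply Hsx; [|exact Hx].
      rewrite Rminus_diag, Rabs_R0; assumption.
    + intros x Hx; apply HCe, Hq1, Hx.
Qed.

Lemma inv_S_pos n : 0 < / INR (S n).
Proof. apply Rinv_0_lt_compat, lt_0_INR; lia. Qed.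

Lemma inv_S_small e : 0 < e -> exists n, forall m, (n <= m)%nat -> / INR (S m) < e.
Proof.
  intros He; destruct (INR_unbounded (/ e)) as [n Hn].
  exists n; intros m Hm.
  rewrite <- (Rinv_inv e); apply Rinv_lt_contravar.
  - apply Rmult_lt_0_compat; [now apply Rinv_0_lt_compat | apply lt_0_INR; lia].
  - apply Rlt_le_trans with (1 := Hn); apply le_INR; lia.
Qed.

(** Otherwise there are countable nets at every scale [/ INR (S k)], and together they yield a dense
    sequence once their centres are moved into [X]. *)
Lemma nonseparable_at_scale (X : E -> Prop) : ~ separable d X ->
  exists e, 0 < e /\ ~ exists s : nat -> E, forall x, X x -> exists n, d x (s n) < e.
Proof.
  intros Hns; apply NNPP; intros Hno; apply Hns.
  destruct (classic (exists x, X x)) as [[x0 Hx0] | Hem];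
    [right | left; intros x Xx; apply Hem; eauto].
  assert (Hs : forall k : nat, exists s : nat -> E,
            forall x, X x -> exists n, d x (s n) < / INR (S k)).
  { intros k; apply NNPP; intros Hk; apply Hno; exists (/ INR (S k)); split;
      [apply inv_S_pos | assumption]. }
  destruct (choice _ Hs) as [s Hs']; clear Hs.
  (* A centre is replaced by a point of [X] in its ball, or by [x0] if the ball misses [X]. This
     doubles the error, hence [e / 2] below. *)
  assert (Ht : forall kn : nat * nat, exists y, X y /\
     ((exists x, X x /\ d x (s (fst kn) (snd kn)) < / INR (S (fst kn))) ->
       d y (s (fst kn) (snd kn)) < / INR (S (fst kn)))).
  { intros [k n]; simpl.
    destruct (classic (exists x, X x /\ d x (s k n) < / INR (S k))) as [[x [Xx Hx]] | Hx];
      [exists x; auto | exists x0; tauto]. }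
  destruct (choice _ Ht) as [t Ht']; clear Ht.
  exists (fun i => t (of_nat i)); split; [intros i; apply Ht'|].
  intros x e Xx He.
  destruct (inv_S_small (e / 2)) as [k Hk]; [lra|]; specialize (Hk k (le_n k)).
  destruct (Hs' k x Xx) as [n Hn].
  exists (to_nat (k, n)); rewrite cancel_of_to.
  destruct (Ht' (k, n)) as [_ H]; cbn [fst snd] in H.
  specialize (H (ex_intro _ x (conj Xx Hn))).
  pose proof (dist_tri x (s k n) (t (k, n))); pose proof (dist_sym (s k n) (t (k, n))); lra.
Qed.

Lemma not_small_seminorm (X : E -> Prop) : ~ separable d X ->
  exists q, seminorm V q /\ seminorm_continuous q /\ ~ small V q X.
Proof.
  intros Hns; destruct (nonseparable_at_scale X Hns) as [e [He Hno]].
  destruct (seminorm_below e He) as [q [Hq [Hc Hqe]]].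
  exists q; split; [assumption|]; split; [assumption|].
  intros [s Hs]; apply Hno; exists s; intros x Xx.
  destruct (Hs x Xx) as [n Hn]; exists n.
  rewrite dist_sym, dist_fnorm; auto.
Qed.

(** Boundedness in the sense of topological vector spaces: [scale_absorbing], uniformly in the
    index. *)
Definition bounded_sequence (z : nat -> E) : Prop :=
  forall e, 0 < e -> exists r, 0 < r /\
    forall m a, Rabs a <= r -> fnorm (vscale V a (z m)) < e.

Lemma bounded_seminorm (q : E -> R) (z : nat -> E) :
  seminorm V q -> seminorm_continuous q -> bounded_sequence z ->
  exists B, 0 < B /\ forall m, q (z m) <= B.
Proof.
  intros Hq Hc Hb; destruct (Hc 1) as [e [He Hqe]]; [lra|].
  destruct (Hb e He) as [r [Hr Hz]].
  exists (/ r); split; [now apply Rinv_0_lt_compat|]; intros m.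
  specialize (Hqe (vscale V r (z m)) (Hz m r (Req_le _ _ (Rabs_pos_eq r (Rlt_le _ _ Hr))))).
  rewrite (proj2 Hq), Rabs_pos_eq in Hqe by lra.
  apply Rmult_le_reg_l with r; [assumption|]; rewrite Rinv_r; lra.
Qed.

(** A non-small set is a countable union of pieces, indexed by [B], on which absorption into the
    ball of radius [/ INR (S j)] is uniform, so some piece is non-small. Doing this for all [j] in
    turn gives decreasing non-small sets [A j]; [z m] is taken in [A m], far from the span of its
    predecessors. *)
Lemma far_bounded_sequence (q : E -> R) (X : E -> Prop) :
  seminorm V q -> ~ small V q X ->
  exists (z : nat -> E) (F : nat -> E -> Prop),
    (forall m, X (z m)) /\ bounded_sequence z /\
    (forall m, subspace V (F m)) /\ (forall m f, F m f -> F (S m) f) /\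
    (forall m, F (S m) (z m)) /\
    (forall m f, F m f -> 1 / 2 <= q (vsub V (z m) f)).
Proof.
  intros Hq HX.
  pose (refine j (A : E -> Prop) (B : nat) := fun x => A x /\
          forall a, Rabs a <= / INR (S B) -> fnorm (vscale V a x) < / INR (S j)).
  assert (Hb : forall p : nat * (E -> Prop), exists B : nat,
             ~ small V q (snd p) -> ~ small V q (refine (fst p) (snd p) B)).
  { intros [j A]; simpl; apply NNPP; intros Hno.
    assert (HA : ~ small V q A) by (intros HA; apply Hno; exists O; tauto).
    apply HA, small_subset with (fun x => exists B, refine j A B x).
    - intros x Ax; destruct (scale_absorbing x (/ INR (S j)) (inv_S_pos j)) as [r [Hr Hrx]].
      destruct (inv_S_small r Hr) as [B HB]; specialize (HB B (le_n B)).
      exists B; split; [assumption|]; intros a Ha; apply Hrx; lra.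
    - apply small_countable_union; intros B.
      apply NNPP; intros HB; apply Hno; exists B; auto. }
  destruct (choice _ Hb) as [beta Hbeta]; clear Hb.
  pose (A := fix A j := match j with
             | O => X
             | S j => refine j (A j) (beta (j, A j)) end).
  assert (HA : forall j, ~ small V q (A j)).
  { induction j as [|j IH]; [exact HX | exact (Hbeta (j, A j) IH)]. }
  assert (HAdec : forall i j x, (i <= j)%nat -> A j x -> A i x).
  { intros i j x Hij; induction Hij as [|j Hij IH]; [auto|]; intros [Hx _]; auto. }
  assert (Hp : forall p : (E -> Prop) * list E, exists z, ~ small V q (fst p) ->
            fst p z /\ forall f, lspan V (snd p) f -> 1 / 2 <= q (vsub V z f)).
  { intros [S l]; destruct (classic (small V q S)) as [HS | HS]; [exists (vzero V); tauto|].
    destruct (far_from_lspan V q Hq S l HS) as [z Hz]; exists z; auto. }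
  destruct (choice _ Hp) as [pick Hpick]; clear Hp.
  pose (l := fix l m := match m with O => nil | S m => pick (A m, l m) :: l m end).
  pose (z := fun m => pick (A m, l m)).
  assert (Hz : forall m, A m (z m) /\ forall f, lspan V (l m) f -> 1 / 2 <= q (vsub V (z m) f)).
  { intros m; exact (Hpick (A m, l m) (HA m)). }
  exists z, (fun m => lspan V (l m)); repeat split.
  - intros m; apply (HAdec 0%nat m); [lia | apply Hz].
  - intros e He; destruct (inv_S_small e He) as [j Hj]; specialize (Hj j (le_n j)).
    (* Membership in [A (S j)] controls [z m] from index [S j] on; the finitely many earlier terms
       are absorbed one at a time. *)
    assert (Hfin : forall k, exists r, 0 < r /\ forall m a, (m < k)%nat -> Rabs a <= r ->
               fnorm (vscale V a (z m)) < e).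
    { induction k as [|k [r [Hr IH]]]; [exists 1; split; [lra | lia]|].
      destruct (scale_absorbing (z k) e He) as [s [Hs Hsz]].
      exists (Rmin r s); split; [now apply Rmin_glb_lt|].
      intros m a Hm Ha; pose proof (Rmin_l r s); pose proof (Rmin_r r s).
      destruct (Nat.eq_dec m k) as [-> | Hmk]; [apply Hsz | apply IH]; try lia; lra. }
    destruct (Hfin (S j)) as [r [Hr Hrz]].
    pose proof (inv_S_pos (beta (j, A j))) as Hpos.
    exists (Rmin r (/ INR (S (beta (j, A j))))); split; [now apply Rmin_glb_lt|].
    intros m a Ha; pose proof (Rmin_l r (/ INR (S (beta (j, A j)))));
      pose proof (Rmin_r r (/ INR (S (beta (j, A j))))).
    destruct (Nat.lt_ge_cases m (S j)) as [Hm | Hm]; [apply Hrz; [assumption | lra]|].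
    destruct (HAdec _ _ _ Hm (proj1 (Hz m))) as [_ Hbd].
    apply Rlt_trans with (2 := Hj), Hbd, Rle_trans with (1 := Ha); assumption.
  - apply lspan_subspace.
  - apply lspan_subspace.
  - apply lspan_subspace.
  - intros m f Hf; simpl; exists 0, f; split; [assumption|]; vec.
  - intros m; simpl; exists 1, (vzero V); split; [apply lspan_subspace|]; unfold z; vec.
  - intros m f Hf; now apply Hz.
Qed.

End Metric.

Definition mix {E : Type} (V : RVectorSpace E) (t : R) (x y : E) : E :=
  vadd V (vscale V (1 - t) x) (vscale V t y).

(** * Separation of the perturbing directions *)

Section Directions.
Context {E : Type} (V : RVectorSpace E) (q : E -> R) (Hq : seminorm V q).
Context (z : nat -> E) (F : nat -> E -> Prop).
Hypothesis F_subspace : forall m, subspace V (F m).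
Hypothesis F_step : forall m f, F m f -> F (S m) f.
Hypothesis F_next : forall m, F (S m) (z m).
Hypothesis z_far : forall m f, F m f -> 1 / 2 <= q (vsub V (z m) f).
Context (B : R).
Hypothesis B_pos : 0 < B.
Hypothesis z_bound : forall m, q (z m) <= B.

Lemma F_mono i j f : (i <= j)%nat -> F i f -> F j f.
Proof. intros Hij; induction Hij; auto. Qed.

Lemma F_dir i j : (i < j)%nat -> F j (z i).
Proof. intros Hij; apply F_mono with (S i); [lia | apply F_next]. Qed.

Lemma F_add m x y : F m x -> F m y -> F m (vadd V x y).
Proof. apply F_subspace. Qed.

Lemma F_scale m a x : F m x -> F m (vscale V a x).
Proof. apply F_subspace. Qed.

(** For nonzero [c], [w] is [c] times the difference of [z i] and an element of [F i], so [z_far]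
    bounds [Rabs c]. Removing the last term, of [q]-size at most [Rabs c * B], gives the second
    bound. *)
Lemma peel_top i g c w : F i g -> w = vadd V g (vscale V c (z i)) ->
  Rabs c / 2 <= q w /\ q g <= (1 + 2 * B) * q w.
Proof.
  intros Hg ->.
  assert (H1 : Rabs c / 2 <= q (vadd V g (vscale V c (z i)))).
  { destruct (Req_dec c 0) as [-> | Hc].
    - rewrite Rabs_R0; pose proof (seminorm_pos V q (vadd V g (vscale V 0 (z i))) Hq); lra.
    - replace (vadd V g (vscale V c (z i)))
        with (vscale V c (vsub V (z i) (vscale V (- / c) g))) by (unfold vsub; vec; assumption).
      rewrite (proj2 Hq).
      pose proof (z_far i _ (F_scale i (- / c) g Hg)).
      pose proof (Rabs_pos_lt c Hc); nra. }
  split; [assumption|].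
  pose proof (seminorm_sub_le V q (vadd V g (vscale V c (z i))) (vscale V c (z i)) Hq) as H2.
  replace (vsub V (vadd V g (vscale V c (z i))) (vscale V c (z i))) with g in H2
    by (unfold vsub; vec).
  rewrite (proj2 Hq) in H2.
  pose proof (z_bound i); pose proof (Rabs_pos c); nra.
Qed.

Ltac in_F := repeat first [apply F_add | apply F_scale | apply F_dir; lia];
  first [eapply F_mono; [|eassumption]; lia].

(* Dropping the term of largest index multiplies [q] by at most [1 + 2 * B], and a coefficient
   is at most twice the value of [q] while its term is the leading one; after at most two steps
   the leading coefficient is at least [1 / 2]. *)
Lemma directions_separated_ordered m1 m2 n1 n2 g h u v :
  (m1 < m2)%nat -> (n1 < n2)%nat -> (m2 < n2)%nat -> m1 <> n1 -> m2 <> n1 ->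
  F m1 g -> F n1 h -> 0 <= u <= 1 -> 0 <= v <= 1 ->
  1 <= 4 * (1 + 2 * B) ^ 2 *
       q (vsub V (vadd V g (mix V u (z m1) (z m2))) (vadd V h (mix V v (z n1) (z n2)))).
Proof.
  intros Hm Hn Hmn H11 H21 Hg Hh Hu Hv.
  set (w := vsub V _ _).
  set (K := 1 + 2 * B); assert (HK : 1 <= K) by (unfold K; lra).
  pose proof (seminorm_pos V q w Hq) as Hw.
  assert (HK2 : K <= K ^ 2) by nra.
  pose (g1 := vadd V (vadd V (vadd V g (vscale V (1 - u) (z m1))) (vscale V u (z m2)))
                     (vadd V (vscale V (-1) h) (vscale V (-(1 - v)) (z n1)))).
  destruct (peel_top n2 g1 (- v) w) as [Hc1 Hg1].
  { unfold g1; in_F. }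
  { unfold w, g1, vsub, mix; vec. }
  fold K in Hg1.
  rewrite Rabs_Ropp, (Rabs_pos_eq v) in Hc1 by lra.
  destruct (Rle_dec (1 / 2) v) as [Hv2 | Hv2]; [nra|].
  destruct (Nat.lt_ge_cases m2 n1) as [Hlt | Hge].
  { destruct (peel_top n1
      (vadd V (vadd V (vadd V g (vscale V (1 - u) (z m1))) (vscale V u (z m2)))
              (vscale V (-1) h)) (-(1 - v)) g1) as [Hc2 _].
    - in_F.
    - unfold g1; vec.
    - rewrite Rabs_Ropp, (Rabs_pos_eq (1 - v)) in Hc2 by lra; nra. }
  pose (g2 := vadd V (vadd V g (vscale V (1 - u) (z m1)))
                     (vadd V (vscale V (-1) h) (vscale V (-(1 - v)) (z n1)))).
  destruct (peel_top m2 g2 u g1) as [Hc2 Hg2].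
  { unfold g2; in_F. }
  { unfold g1, g2; vec. }
  fold K in Hg2.
  rewrite (Rabs_pos_eq u) in Hc2 by lra.
  destruct (Rle_dec (1 / 2) u) as [Hu2 | Hu2]; [nra|].
  (* Both candidates left for the leading term, at [m1] and [n1], have coefficients above [1 / 2] in
     absolute value, so [q g2] exceeds [1 / 4]; hence the factor [4 * (1 + 2 * B) ^ 2]. *)
  assert (Hg2w : q g2 <= K ^ 2 * q w) by (simpl; nra).
  destruct (Nat.lt_ge_cases m1 n1) as [Hlt | Hge'].
  - destruct (peel_top n1 (vadd V (vadd V g (vscale V (1 - u) (z m1))) (vscale V (-1) h))
                (-(1 - v)) g2) as [Hc3 _].
    + in_F.
    + unfold g2; vec.
    + rewrite Rabs_Ropp, (Rabs_pos_eq (1 - v)) in Hc3 by lra; nra.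
  - destruct (peel_top m1 (vadd V g (vadd V (vscale V (-1) h) (vscale V (-(1 - v)) (z n1))))
                (1 - u) g2) as [Hc3 _].
    + in_F.
    + unfold g2; vec.
    + rewrite (Rabs_pos_eq (1 - u)) in Hc3 by lra; nra.
Qed.

Lemma directions_separated m1 m2 n1 n2 g h u v :
  (m1 < m2)%nat -> (n1 < n2)%nat -> m1 <> n1 -> m1 <> n2 -> m2 <> n1 -> m2 <> n2 ->
  F m1 g -> F n1 h -> 0 <= u <= 1 -> 0 <= v <= 1 ->
  1 <= 4 * (1 + 2 * B) ^ 2 *
       q (vsub V (vadd V g (mix V u (z m1) (z m2))) (vadd V h (mix V v (z n1) (z n2)))).
Proof.
  intros; destruct (Nat.lt_ge_cases m2 n2).
  - apply directions_separated_ordered; assumption.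
  - rewrite seminorm_sub_comm by assumption.
    apply directions_separated_ordered; auto; lia.
Qed.

End Directions.

(** * Continuity *)

Section Continuity.
Context {E : Type} (V : RVectorSpace E) (d : E -> E -> R) (HF : frechet_space V d).
Context (X : E -> Prop).

Definition cont_fun (f : E -> R) (x : E) : Prop :=
  forall e, 0 < e -> exists r, 0 < r /\ forall y, X y -> d x y < r -> Rabs (f x - f y) < e.

Definition cont_map (f : E -> E) (x : E) : Prop :=
  forall e, 0 < e -> exists r, 0 < r /\ forall y, X y -> d x y < r -> d (f x) (f y) < e.

Lemma cont_map_add f g x :
  cont_map f x -> cont_map g x -> cont_map (fun y => vadd V (f y) (g y)) x.
Proof.
  intros Hf Hg e He.
  destruct (Hf (e / 2)) as [r [Hr Hrf]]; [lra|].
  destruct (Hg (e / 2)) as [s [Hs Hsg]]; [lra|].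
  exists (Rmin r s); split; [now apply Rmin_glb_lt|].
  intros y Xy Hy; pose proof (Rmin_l r s); pose proof (Rmin_r r s).
  specialize (Hrf y Xy ltac:(lra)); specialize (Hsg y Xy ltac:(lra)).
  rewrite (dist_fnorm V d HF) in Hrf, Hsg |- *.
  replace (vsub V (vadd V (f y) (g y)) (vadd V (f x) (g x)))
    with (vadd V (vsub V (f y) (f x)) (vsub V (g y) (g x))) by (unfold vsub; vec).
  pose proof (fnorm_add V d HF (vsub V (f y) (f x)) (vsub V (g y) (g x))); lra.
Qed.

Lemma cont_map_scale c f x :
  cont_fun c x -> cont_map f x -> cont_map (fun y => vscale V (c y) (f y)) x.
Proof.
  intros Hc Hf e He.
  destruct (scale_continuous V d HF (c x) (f x) e He) as [k [Hk Hcf]].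
  destruct (Hc k Hk) as [r [Hr Hrc]].
  destruct (Hf k Hk) as [s [Hs Hsf]].
  exists (Rmin r s); split; [now apply Rmin_glb_lt|].
  intros y Xy Hy; pose proof (Rmin_l r s); pose proof (Rmin_r r s).
  apply Hcf; [apply Hrc | apply Hsf]; trivial; lra.
Qed.

Lemma cont_map_const a x : cont_map (fun _ => a) x.
Proof. intros e He; exists 1; split; [lra|]; intros; now rewrite (dist_refl V d HF). Qed.

Lemma cont_map_id x : cont_map (fun y => y) x.
Proof. intros e He; exists e; auto. Qed.

Lemma cont_fun_lipschitz f x :
  (forall y, X y -> Rabs (f x - f y) <= d x y) -> cont_fun f x.
Proof.
  intros H e He; exists e; split; [assumption|].
  intros y Xy Hy; apply Rle_lt_trans with (2 := Hy); auto.
Qed.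

Lemma continuity_pt_eps phi a e : continuity_pt phi a -> 0 < e ->
  exists r, 0 < r /\ forall b, Rabs (a - b) < r -> Rabs (phi a - phi b) < e.
Proof.
  intros H He; destruct (H e He) as [r [Hr Hphi]]; simpl in Hphi.
  exists r; split; [assumption|]; intros b Hb.
  destruct (Req_dec a b) as [<- | Hab]; [now rewrite Rminus_diag, Rabs_R0|].
  rewrite Rabs_minus_sym; apply Hphi; unfold R_dist; rewrite Rabs_minus_sym.
  split; [split; [exact I | assumption] | assumption].
Qed.

Lemma cont_fun_comp phi f x :
  continuity_pt phi (f x) -> cont_fun f x -> cont_fun (fun y => phi (f y)) x.
Proof.
  intros Hphi Hf e He.
  destruct (continuity_pt_eps phi (f x) e Hphi He) as [s [Hs Hsphi]].
  destruct (Hf s Hs) as [r [Hr Hrf]]; exists r; auto.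
Qed.

Definition clamp (v : R) : R := Rmax 0 (Rmin 1 v).

Lemma clamp_continuous v : continuity_pt clamp v.
Proof.
  intros e He; exists e; split; [assumption|].
  intros w [_ Hw]; apply Rle_lt_trans with (2 := Hw); simpl; unfold R_dist, clamp.
  unfold Rmax, Rmin, Rabs; repeat destruct Rle_dec; repeat destruct Rcase_abs; lra.
Qed.

(** The polygonal path through [y 0], ..., [y n], written as a sum of clamped increments so that its
    continuity follows by induction. *)
Fixpoint path (y : nat -> E) (n : nat) (s : R) : E :=
  match n with
  | O => y O
  | S j => vadd V (path y j s) (vscale V (clamp (s - INR j)) (vsub V (y (S j)) (y j)))
  end.

Lemma path_end y n s : INR n <= s -> path y n s = y n.
Proof.
  induction n as [|n IH]; intros Hs; [reflexivity|]; rewrite S_INR in Hs.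
  cbn [path]; rewrite IH by lra.
  replace (clamp (s - INR n)) with 1; [unfold vsub; vec|].
  unfold clamp, Rmax, Rmin; repeat destruct Rle_dec; lra.
Qed.

(** Earlier clamps are already [1] and later ones still [0], so truncations at different [n] above
    [k] agree here. *)
Lemma path_value y n k s : (k < n)%nat -> INR k <= s <= INR k + 1 ->
  path y n s = mix V (s - INR k) (y k) (y (S k)).
Proof.
  intros Hkn Hs; induction Hkn as [|n Hkn IH]; cbn [path].
  - rewrite path_end by lra.
    replace (clamp (s - INR k)) with (s - INR k); [unfold mix, vsub; vec|].
    unfold clamp, Rmax, Rmin; repeat destruct Rle_dec; lra.
  - rewrite IH.
    assert (INR k + 1 <= INR n) by (rewrite <- S_INR; apply le_INR; lia).
    replace (clamp (s - INR n)) with 0; [unfold mix, vsub; vec|].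
    unfold clamp, Rmax, Rmin; repeat destruct Rle_dec; lra.
Qed.

Lemma cont_map_path y n f x : cont_fun f x -> cont_map (fun w => path y n (f w)) x.
Proof.
  intros Hf; induction n as [|n IH]; cbn [path]; [apply cont_map_const|].
  apply cont_map_add; [assumption|]; apply cont_map_scale; [|apply cont_map_const].
  apply (cont_fun_comp (fun s => clamp (s - INR n))); [|assumption].
  apply (continuity_pt_comp (fun s => s - INR n)); [reg | apply clamp_continuous].
Qed.

Lemma seminorm_dist q x e : seminorm V q -> seminorm_continuous V d q -> 0 < e ->
  exists r, 0 < r /\ forall y, d x y < r -> q (vsub V x y) < e.
Proof.
  intros Hq Hc He; destruct (Hc e He) as [r [Hr Hrq]]; exists r; split; [assumption|].
  intros y Hy; rewrite (seminorm_sub_comm V q x y Hq); apply Hrq.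
  rewrite <- (dist_fnorm V d HF); assumption.
Qed.

End Continuity.

Definition nat_floor (s : R) : nat := Z.to_nat (up s - 1).

Lemma nat_floor_spec s : 0 <= s -> INR (nat_floor s) <= s < INR (nat_floor s) + 1.
Proof.
  intros Hs; destruct (archimed s) as [H1 H2]; unfold nat_floor.
  assert (0 < up s)%Z by (apply lt_IZR; lra).
  rewrite INR_IZR_INZ, Z2Nat.id by lia; rewrite minus_IZR; lra.
Qed.

Lemma cluster_point (u : nat -> R) : (forall j, 0 <= u j <= 1) ->
  exists l, forall e N, 0 < e -> exists j, (N <= j)%nat /\ Rabs (l - u j) < e.
Proof.
  intros Hu; destruct (Bolzano_Weierstrass u _ (compact_P3 0 1) Hu) as [l Hl].
  exists l; intros e N He.
  destruct (Hl (disc l (mkposreal e He)) N) as [j [Hj Hd]].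
  - exists (mkposreal e He); intros y Hy; exact Hy.
  - exists j; split; [assumption|]; rewrite Rabs_minus_sym; exact Hd.
Qed.

(** * Construction of the approximations *)

Section Approximation.
Context {E : Type} (V : RVectorSpace E) (d : E -> E -> R) (HF : frechet_space V d).
Context (X : E -> Prop) (Hconv : convex V X).
Context (q : E -> R) (Hq : seminorm V q) (Hqc : seminorm_continuous V d q).
Context (z : nat -> E) (F : nat -> E -> Prop).
Hypothesis z_in : forall m, X (z m).
Hypothesis z_bounded : bounded_sequence V d z.
Hypothesis F_subspace : forall m, subspace V (F m).
Hypothesis F_step : forall m f, F m f -> F (S m) f.
Hypothesis F_next : forall m, F (S m) (z m).
Hypothesis z_far : forall m f, F m f -> 1 / 2 <= q (vsub V (z m) f).
Context (B : R).
Hypothesis B_pos : 0 < B.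
Hypothesis z_bound : forall m, q (z m) <= B.

Lemma mix_in t x y : X x -> X y -> 0 <= t <= 1 -> X (mix V t x y).
Proof.
  intros Xx Xy Ht; unfold mix.
  replace (vscale V t y) with (vscale V (1 - (1 - t)) y) by vec.
  apply Hconv; trivial; lra.
Qed.

Lemma scaled_mix_small e : 0 < e -> exists r, 0 < r /\ forall s m k u,
  Rabs s <= r -> 0 <= u <= 1 -> fnorm V d (vscale V s (mix V u (z m) (z k))) < e.
Proof.
  intros He; destruct (z_bounded (e / 2)) as [r [Hr Hz]]; [lra|].
  exists r; split; [assumption|]; intros s m k u Hs Hu.
  replace (vscale V s (mix V u (z m) (z k)))
    with (vadd V (vscale V (s * (1 - u)) (z m)) (vscale V (s * u) (z k)))
    by (unfold mix; vec).
  apply Rle_lt_trans with (1 := fnorm_add V d HF _ _).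
  pose proof (Rabs_pos s).
  assert (Rabs (s * (1 - u)) <= r)
    by (rewrite Rabs_mult, (Rabs_pos_eq (1 - u)) by lra; nra).
  assert (Rabs (s * u) <= r) by (rewrite Rabs_mult, (Rabs_pos_eq u) by lra; nra).
  pose proof (Hz m (s * (1 - u)) ltac:(assumption)).
  pose proof (Hz k (s * u) ltac:(assumption)); lra.
Qed.

(** [lebesgue_function] is applied to the radii [r] for which one member of the cover contains the
    [r]-ball together with all moves of its points, by steps at most [r], towards segments between
    the [z m]. *)
Lemma step_size (cover : (E -> Prop) -> Prop) :
  (forall U, cover U -> open_in d X U) ->
  (forall x, X x -> exists U, cover U /\ U x) ->
  exists t : E -> R,
    (forall x, X x -> 0 < t x <= 1 / 2) /\
    (forall x y, X x -> X y -> Rabs (t x - t y) <= d x y) /\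
    forall x m k u, X x -> 0 <= u <= 1 ->
      exists U, cover U /\ U x /\ U (mix V (t x) x (mix V u (z m) (z k))).
Proof.
  intros Hopen Hcov.
  destruct (lebesgue_function d X (fun x r => exists U, cover U /\
     forall y, X y -> d x y < r -> U y /\ forall s m k u, 0 <= s <= r -> s <= 1 -> 0 <= u <= 1 ->
       U (mix V s y (mix V u (z m) (z k))))) as [l [Hl Hlip]].
  - apply (dist_refl V d HF).
  - apply (dist_pos V d HF).
  - apply (dist_sym V d HF).
  - intros x y r r' Xx Xy [U [HU H]] Hr' Hxy; exists U; split; [assumption|].
    intros w Xw Hw; pose proof (dist_tri V d HF x y w); pose proof (dist_pos V d HF x y).
    destruct (H w Xw) as [HU1 HU2]; [lra|]; split; [assumption|].
    intros; apply HU2; trivial; lra.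
  - intros x Xx; destruct (Hcov x Xx) as [U [HU Ux]].
    destruct (proj2 (Hopen U HU) x Ux) as [e [He HeU]].
    (* The distance from [x] to the moved point is split into [d x y], the part removed from [y] and
       the part added from the segment. *)
    destruct (scale_continuous V d HF 0 x (e / 3)) as [r1 [Hr1 H1]]; [lra|].
    destruct (scaled_mix_small (e / 3)) as [r2 [Hr2 H2]]; [lra|].
    pose (r := Rmin (r1 / 2) (Rmin r2 (e / 3))).
    assert (Hr : 0 < r /\ r <= r1 / 2 /\ r <= r2 /\ r <= e / 3).
    { unfold r; pose proof (Rmin_l (r1 / 2) (Rmin r2 (e / 3)));
        pose proof (Rmin_r (r1 / 2) (Rmin r2 (e / 3)));
        pose proof (Rmin_l r2 (e / 3)); pose proof (Rmin_r r2 (e / 3)).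
      split; [repeat apply Rmin_glb_lt|]; lra. }
    exists r; split; [tauto|]; exists U; split; [assumption|].
    intros y Xy Hy; split; [apply HeU; trivial; lra|].
    intros s m k u Hs Hs1 Hu; apply HeU; [repeat apply mix_in; trivial; lra|].
    pose proof (dist_tri V d HF x y (mix V s y (mix V u (z m) (z k)))) as Ht.
    rewrite (dist_fnorm V d HF y) in Ht.
    replace (vsub V (mix V s y (mix V u (z m) (z k))) y)
      with (vadd V (vscale V (- s) y) (vscale V s (mix V u (z m) (z k)))) in Ht
      by (unfold vsub, mix; vec).
    pose proof (fnorm_add V d HF (vscale V (- s) y) (vscale V s (mix V u (z m) (z k)))).
    assert (fnorm V d (vscale V (- s) y) < e / 3).
    { unfold fnorm; rewrite <- (vscale_0_l V x); apply H1; [|lra].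
      rewrite Rminus_0_l, Ropp_involutive, Rabs_pos_eq; lra. }
    assert (fnorm V d (vscale V s (mix V u (z m) (z k))) < e / 3).
    { apply H2; [rewrite Rabs_pos_eq|]; lra. }
    lra.
  (* Halving keeps [1 - t x] at least [1 / 2], so that [x] can be recovered from its image. *)
  - exists (fun x => l x / 2); split; [|split].
    + intros x Xx; destruct (Hl x Xx); lra.
    + intros x y Xx Xy; pose proof (Hlip x y Xx Xy); pose proof (dist_pos V d HF x y).
      replace (l x / 2 - l y / 2) with ((l x - l y) / 2) by field.
      unfold Rdiv; rewrite Rabs_mult, (Rabs_pos_eq (/ 2)) by lra; lra.
    + intros x m k u Xx Hu; destruct (Hl x Xx) as [Hlx [U [HU H]]].
      destruct (H x Xx) as [H1 H2]; [rewrite (dist_refl V d HF); lra|].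
      exists U; split; [assumption|]; split; [assumption|]; apply H2; lra.
Qed.

Definition union_space (x : E) : Prop := exists m, F m x.

Lemma union_subspace : subspace V union_space.
Proof.
  split; [|split].
  - exists O; apply F_subspace.
  - intros x y [i Hx] [j Hy]; exists (Nat.max i j); apply F_subspace;
      eapply F_mono; try eassumption; lia.
  - intros a x [i Hx]; exists i; now apply F_subspace.
Qed.

(* Chosen so that [3 * theta] is below the lower bound in [directions_separated]. *)
Definition theta : R := / (16 * (1 + 2 * B) ^ 2).

Lemma theta_pos : 0 < theta.
Proof. apply Rinv_0_lt_compat; assert (0 < (1 + 2 * B) ^ 2) by (apply pow_lt; lra); lra. Qed.

(** This is [locally_finite_choice] for the quotient seminorm by [union_space], rescaled so that
    radius [1] becomes [theta]. *)
Lemma coset_choice : exists a : E -> E,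
  forall p, exists r, 0 < r /\ exists L : list E,
    (forall b, In b L -> exists f, union_space f /\ q (vsub V (vsub V p b) f) < theta) /\
    forall y f, union_space f -> q (vsub V (vsub V p y) f) < r -> In (a y) L.
Proof.
  destruct (quotient_seminorm V q union_space Hq union_subspace) as [P [HP [HPle HPlt]]].
  pose proof theta_pos as Hth.
  assert (Hdiv : forall x y, P x / theta < y <-> P x < y * theta).
  { intros x y; split; intros H.
    - apply Rmult_lt_compat_r with (r := theta) in H; [|assumption].
      now replace (P x / theta * theta) with (P x) in H by (field; lra).
    - apply Rmult_lt_reg_r with theta; [assumption|].
      now replace (P x / theta * theta) with (P x) by (field; lra). }
  destruct (locally_finite_choice (fun x y => P (vsub V x y) / theta)) as [a Hloc].
  - intros x y; apply Rle_mult_inv_pos; [apply (seminorm_pos V P _ HP) | assumption].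
  - intros x; replace (vsub V x x) with (vzero V) by (unfold vsub; vec).
    rewrite (seminorm_zero V P HP); field; lra.
  - intros x y; now rewrite (seminorm_sub_comm V P x y HP).
  - intros x y w; pose proof (seminorm_tri V P x y w HP).
    unfold Rdiv; rewrite <- Rmult_plus_distr_r.
    apply Rmult_le_compat_r; [left; now apply Rinv_0_lt_compat | assumption].
  - assert (Hnear : forall x y, P (vsub V x y) / theta < 1 ->
              exists f, union_space f /\ q (vsub V (vsub V x y) f) < theta).
    { intros x y H; apply HPlt; apply Hdiv in H; lra. }
    exists a; intros p; destruct (Hloc p) as [r [Hr [L [HL Hin]]]].
    exists (r * theta); split; [now apply Rmult_lt_0_compat|].
    exists L; split; [auto|]; intros y f Hf Hlt; apply Hin, Hdiv.
    apply Rle_lt_trans with (2 := Hlt); now apply HPle.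
Qed.

(** * Levels of points and local finiteness of the images *)

Section Perturbation.
Context (t : E -> R).
Hypothesis t_range : forall x, X x -> 0 < t x <= 1 / 2.
Hypothesis t_lip : forall x y, X x -> X y -> Rabs (t x - t y) <= d x y.
Context (a : E -> E).
Hypothesis a_local : forall p, exists r, 0 < r /\ exists L : list E,
    (forall b, In b L -> exists f, union_space f /\ q (vsub V (vsub V p b) f) < theta) /\
    forall y f, union_space f -> q (vsub V (vsub V p y) f) < r -> In (a y) L.

(** Dividing [(1 - t) x + t w] by [t (1 - t)] gives [x / t + w / (1 - t)], so for [w] in
    [union_space] the image and the step determine this vector modulo [union_space]. *)
Definition scaled (x : E) : E := vscale V (/ t x) x.

Definition at_level (k : nat) (x : E) : Prop :=
  exists f, F k f /\ q (vsub V (vsub V (scaled x) (a (scaled x))) f) < theta.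

(** Near [x] the values of [a] lie in a finite list, so one [m] serves all of them. The inequalities
    are strict, and their common slack [s] absorbs the change of [scaled]. *)
Lemma at_level_near x : X x -> exists r m, 0 < r /\
  forall y, X y -> d x y < r -> at_level m y.
Proof.
  intros Xx; destruct (a_local (scaled x)) as [r0 [Hr0 [L [HL Hin]]]].
  assert (Hfin : forall L', (forall b, In b L' -> In b L) -> exists m s, 0 < s /\
     forall b, In b L' -> exists f, F m f /\ q (vsub V (vsub V (scaled x) b) f) < theta - s).
  { induction L' as [|b L' IH]; intros Hsub.
    - exists O, 1; split; [lra | intros b []].
    - destruct IH as [m [s [Hs IH]]]; [intros; apply Hsub; now right|].
      destruct (HL b (Hsub b (or_introl eq_refl))) as [f [[i Hf] Hlt]].
      pose (s' := (theta - q (vsub V (vsub V (scaled x) b) f)) / 2).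
      exists (Nat.max m i), (Rmin s s'); split; [apply Rmin_glb_lt; unfold s'; lra|].
      pose proof (Rmin_l s s'); pose proof (Rmin_r s s').
      intros c [<- | Hc].
      + exists f; split; [eapply F_mono; try eassumption; lia | unfold s' in *; lra].
      + destruct (IH c Hc) as [g [Hg Hglt]]; exists g; split; [|lra].
        eapply F_mono; try eassumption; lia. }
  destruct (Hfin L (fun b Hb => Hb)) as [m [s [Hs Hm]]].
  assert (Hmin : 0 < Rmin r0 s) by now apply Rmin_glb_lt.
  destruct (seminorm_dist V d HF q (scaled x) _ Hq Hqc Hmin) as [r1 [Hr1 H1]].
  pose proof (t_range x Xx) as Htx.
  assert (Hc : cont_map d X scaled x).
  { unfold scaled; apply (cont_map_scale V d HF X (fun y => / t y)); [|apply cont_map_id].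
    apply (cont_fun_comp d X Rinv t); [|apply cont_fun_lipschitz; auto].
    apply (continuity_pt_inv id); [reg | unfold id; lra]. }
  destruct (Hc r1 Hr1) as [r [Hr Hry]].
  exists r, m; split; [assumption|]; intros y Xy Hy.
  specialize (H1 _ (Hry y Xy Hy)).
  pose proof (Rmin_l r0 s); pose proof (Rmin_r r0 s).
  destruct (Hm (a (scaled y))) as [f [Hf Hlt]].
  - apply Hin with (vzero V); [exists O; apply F_subspace|].
    replace (vsub V (vsub V (scaled x) (scaled y)) (vzero V))
      with (vsub V (scaled x) (scaled y)) by (unfold vsub; vec).
    lra.
  - exists f; split; [assumption|].
    rewrite (seminorm_sub_comm V q _ _ Hq) in H1.
    pose proof (proj1 Hq (vsub V (scaled y) (scaled x))
                  (vsub V (vsub V (scaled x) (a (scaled y))) f)) as Ht.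
    replace (vadd V (vsub V (scaled y) (scaled x)) (vsub V (vsub V (scaled x) (a (scaled y))) f))
      with (vsub V (vsub V (scaled y) (a (scaled y))) f) in Ht by (unfold vsub; vec).
    lra.
Qed.

(** Makes the local bounds of [at_level_near] into a continuous one, [/ h x]. *)
Lemma level_function : exists h : E -> R,
  (forall x, X x -> 0 < h x <= 1) /\
  (forall x y, X x -> X y -> Rabs (h x - h y) <= d x y) /\
  forall x k, X x -> 1 <= h x * INR k -> at_level k x.
Proof.
  destruct (lebesgue_function d X (fun x r => forall y, X y -> d x y < r ->
              forall k, 1 <= r * INR k -> at_level k y)) as [h [Hh Hlip]].
  - apply (dist_refl V d HF).
  - apply (dist_pos V d HF).
  - apply (dist_sym V d HF).
  - intros x y r r' Xx Xy H Hr' Hxy w Xw Hw k Hk.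
    pose proof (dist_tri V d HF x y w); pose proof (dist_pos V d HF x y).
    apply H; trivial; [lra|]; pose proof (pos_INR k); nra.
  - intros x Xx; destruct (at_level_near x Xx) as [r [m [Hr H]]].
    pose proof (inv_S_pos m) as Hm.
    (* For a radius at most [/ INR (S m)], the condition on [k] forces [k > m]. *)
    exists (Rmin r (/ INR (S m))); split; [now apply Rmin_glb_lt|].
    pose proof (Rmin_l r (/ INR (S m))); pose proof (Rmin_r r (/ INR (S m))).
    intros y Xy Hy k Hk.
    destruct (H y Xy ltac:(lra)) as [f [Hf Hlt]].
    exists f; split; [|assumption]; apply (F_mono F F_step m); [|assumption].
    assert (INR (S m) <= INR k).
    { apply Rmult_le_reg_l with (/ INR (S m)); [assumption|].
      rewrite Rinv_l by (apply not_0_INR; lia); pose proof (pos_INR k); nra. }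
    apply INR_le in H2; lia.
  - exists h; split; [intros x Xx; apply Hh, Xx|]; split; [assumption|].
    intros x k Xx Hk; apply (proj2 (Hh x Xx)); trivial.
    rewrite (dist_refl V d HF); apply Hh, Xx.
Qed.

(** Each [n] gets its own row of the Cantor pairing: rows are disjoint, increase in [k] and dominate
    [k]. *)
Definition index (n k : nat) : nat := to_nat (n, k).

Lemma index_mono n k : (index n k < index n (S k))%nat.
Proof.
  unfold index; pose proof (to_nat_spec n k); pose proof (to_nat_spec n (S k)); nia.
Qed.

Lemma index_ge n k : (k <= index n k)%nat.
Proof. unfold index; pose proof (to_nat_non_decreasing n k); lia. Qed.

Lemma index_neq n k n' k' : n <> n' -> index n k <> index n' k'.
Proof.
  intros Hn H; apply Hn; unfold index in H.
  apply (f_equal of_nat) in H; rewrite !cancel_of_to in H; congruence.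
Qed.

Context (f : nat -> E -> E).
Hypothesis f_form : forall n x, X x -> exists k u, 0 <= u <= 1 /\ at_level k x /\
  f n x = mix V (t x) x (mix V u (z (index n k)) (z (index n (S k)))).

(** If [t x] is small and the image is near [p], then so is [x], recovered by subtracting [t w] and
    dividing by [1 - t]; but then [t_lip] keeps [t x] above [t p / 2]. *)
Lemma step_bounded_below p : X p -> exists r, 0 < r /\
  forall n x, X x -> d p (f n x) < r -> r <= t x.
Proof.
  intros Xp; pose proof (t_range p Xp) as Htp.
  destruct (scale_continuous V d HF 1 p (t p / 2)) as [r1 [Hr1 H1]]; [lra|].
  destruct (scaled_mix_small (r1 / 2)) as [r2 [Hr2 H2]]; [lra|].
  pose (r := Rmin (r1 / 2) (Rmin r2 (t p / 2))).
  assert (Hr : 0 < r /\ r <= r1 / 2 /\ r <= r2 /\ r <= t p / 2).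
  { unfold r; pose proof (Rmin_l (r1 / 2) (Rmin r2 (t p / 2)));
      pose proof (Rmin_r (r1 / 2) (Rmin r2 (t p / 2)));
      pose proof (Rmin_l r2 (t p / 2)); pose proof (Rmin_r r2 (t p / 2)).
    split; [repeat apply Rmin_glb_lt|]; lra. }
  exists r; split; [tauto|]; intros n x Xx Hx.
  apply Rnot_lt_le; intros Hlt.
  pose proof (t_range x Xx) as Htx.
  destruct (f_form n x Xx) as [k [u [Hu [_ Hf]]]].
  set (w := mix V u _ _) in Hf.
  assert (Hw : fnorm V d (vscale V (- t x) w) < r1 / 2).
  { apply H2; [rewrite Rabs_Ropp, Rabs_pos_eq; lra | assumption]. }
  assert (Hpx : d p x < t p / 2).
  { rewrite <- (vscale_one E V p) at 1.
    replace x with (vscale V (/ (1 - t x)) (vadd V (f n x) (vscale V (- t x) w))) at 1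
      by (rewrite Hf; unfold mix; vec).
    apply H1.
    - replace (1 - / (1 - t x)) with (- (t x * / (1 - t x))) by (field; lra).
      rewrite Rabs_Ropp, Rabs_pos_eq.
      + assert (/ (1 - t x) <= 2).
        { rewrite <- (Rinv_inv 2); apply Rinv_le_contravar; lra. }
        nra.
      + left; apply Rmult_lt_0_compat; [lra | apply Rinv_0_lt_compat; lra].
    - pose proof (dist_tri V d HF p (f n x) (vadd V (f n x) (vscale V (- t x) w))) as Ht.
      rewrite (dist_fnorm V d HF (f n x)) in Ht.
      replace (vsub V (vadd V (f n x) (vscale V (- t x) w)) (f n x))
        with (vscale V (- t x) w) in Ht by (unfold vsub; vec).
      lra. }
  pose proof (t_lip p x Xp Xx) as Hl; revert Hl; unfold Rabs; destruct Rcase_abs; lra.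
Qed.

Lemma list_bound (L : list E) : exists M, 0 < M /\ forall b, In b L -> q b <= M.
Proof.
  induction L as [|b L [M [HM IH]]]; [exists 1; split; [lra | intros b []]|].
  exists (Rmax M (q b)); pose proof (Rmax_l M (q b)); pose proof (Rmax_r M (q b)).
  split; [lra|]; intros c [<- | Hc]; [assumption|]; specialize (IH c Hc); lra.
Qed.

(** A common representative [b] nearly cancels, which leaves two vectors as in
    [directions_separated] that are too close to each other. *)
Lemma images_apart n n' x x' b c :
  X x -> X x' -> n <> n' -> a (scaled x) = b -> a (scaled x') = b ->
  q (vsub V c (vscale V (/ t x) (f n x))) < theta / 4 ->
  q (vsub V c (vscale V (/ t x') (f n' x'))) < theta / 4 ->
  Rabs (t x - t x') * q b <= theta / 2 -> False.
Proof.
  intros Xx Xx' Hn Ha Ha' Hc Hc' Hb.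
  pose proof (t_range x Xx) as Ht; pose proof (t_range x' Xx') as Ht'.
  destruct (f_form n x Xx) as [k [u [Hu [[g [Hg Hgq]] Hf]]]].
  destruct (f_form n' x' Xx') as [k' [u' [Hu' [[g' [Hg' Hgq']] Hf']]]].
  rewrite Ha in Hgq; rewrite Ha' in Hgq'.
  pose proof (directions_separated V q Hq z F F_subspace F_step F_next z_far B B_pos z_bound
    (index n k) (index n (S k)) (index n' k') (index n' (S k'))
    (vscale V (1 - t x) g) (vscale V (1 - t x') g') u u'
    (index_mono _ _) (index_mono _ _) (index_neq _ _ _ _ Hn) (index_neq _ _ _ _ Hn)
    (index_neq _ _ _ _ Hn) (index_neq _ _ _ _ Hn)
    (F_scale V F F_subspace _ _ _ (F_mono F F_step _ _ _ (index_ge n k) Hg))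
    (F_scale V F F_subspace _ _ _ (F_mono F F_step _ _ _ (index_ge n' k') Hg')) Hu Hu') as Hsep.
  set (w := mix V u (z (index n k)) (z (index n (S k)))) in *.
  set (w' := mix V u' (z (index n' k')) (z (index n' (S k')))) in *.
  set (y := vsub V c (vscale V (/ t x) (f n x))) in *.
  set (y' := vsub V c (vscale V (/ t x') (f n' x'))) in *.
  set (o := vsub V (vsub V (scaled x) b) g) in *.
  set (o' := vsub V (vsub V (scaled x') b) g') in *.
  (* Each image divided by its step is [(1 - t) (b + g + o) + w]; in the difference only
     [(t - t') b] survives of the representative. *)
  assert (Hid : vsub V (vadd V (vscale V (1 - t x) g) w) (vadd V (vscale V (1 - t x') g') w') =
    vadd V (vsub V y' y) (vadd V (vscale V (t x - t x') b)
      (vsub V (vscale V (1 - t x') o') (vscale V (1 - t x) o)))).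
  { unfold y, y', o, o', scaled; rewrite Hf, Hf'; unfold mix, vsub; fold w w'.
    clearbody w w'; vec. }
  rewrite Hid in Hsep; clear Hid.
  pose proof (proj1 Hq (vsub V y' y) (vadd V (vscale V (t x - t x') b)
      (vsub V (vscale V (1 - t x') o') (vscale V (1 - t x) o)))) as T1.
  pose proof (proj1 Hq (vscale V (t x - t x') b)
      (vsub V (vscale V (1 - t x') o') (vscale V (1 - t x) o))) as T2.
  pose proof (seminorm_sub_le V q y' y Hq) as T3.
  pose proof (seminorm_sub_le V q (vscale V (1 - t x') o') (vscale V (1 - t x) o) Hq) as T4.
  rewrite !(proj2 Hq) in T4; rewrite (proj2 Hq) in T2.
  rewrite (Rabs_pos_eq (1 - t x)), (Rabs_pos_eq (1 - t x')) in T4 by lra.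
  pose proof (seminorm_pos V q o Hq); pose proof (seminorm_pos V q o' Hq).
  set (S := q (vadd V (vsub V y' y) _)) in *.
  (* The terms [y], [y'] give [theta / 2], the multiple of [b] gives [theta / 2], and [o], [o'] give
     [2 * theta]. The separation bound would then read [1 <= 3 / 4]. *)
  assert (HS : S <= 3 * theta) by nra.
  pose proof theta_pos as Hth.
  assert (HK : 0 < (1 + 2 * B) ^ 2) by (apply pow_lt; lra).
  assert (Hth16 : 16 * (1 + 2 * B) ^ 2 * theta = 1) by (unfold theta; field; lra).
  nra.
Qed.

(** Otherwise images with unbounded indices converge to [p]. Their steps cluster at some [s],
    positive by [step_bounded_below]; the classes then cluster too, two points share a
    representative, and [images_apart] applies. *)
Lemma images_locally_finite p : X p -> exists r, 0 < r /\
  exists N, forall n x, X x -> d p (f n x) < r -> (n < N)%nat.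
Proof.
  intros Xp; apply NNPP; intros Hno.
  assert (Hseq : forall j : nat, exists nx : nat * E, (j <= fst nx)%nat /\ X (snd nx) /\
            d p (f (fst nx) (snd nx)) < / INR (S j)).
  { intros j; apply NNPP; intros Hj; apply Hno.
    exists (/ INR (S j)); split; [apply inv_S_pos|]; exists j; intros n x Xx Hd.
    apply Nat.nle_gt; intros Hle; apply Hj; exists (n, x); auto. }
  destruct (choice _ Hseq) as [nx Hnx]; clear Hseq.
  pose (N := fun j => fst (nx j)); pose (x := fun j => snd (nx j)).
  assert (HN : forall j, (j <= N j)%nat) by apply Hnx.
  assert (HX : forall j, X (x j)) by apply Hnx.
  assert (Hd : forall j, d p (f (N j) (x j)) < / INR (S j)) by apply Hnx.
  clearbody N x; clear nx Hnx.
  destruct (cluster_point (fun j => t (x j))) as [s Hs].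
  { intros j; specialize (t_range _ (HX j)); lra. }
  destruct (step_bounded_below p Xp) as [r0 [Hr0 Hlow]].
  destruct (inv_S_small r0 Hr0) as [j0 Hj0].
  assert (Hsr : r0 <= s <= 1 / 2).
  { split; apply Rnot_lt_le; intros Hlt.
    - destruct (Hs (r0 - s) j0) as [j [Hj Hsj]]; [lra|].
      specialize (Hj0 j Hj); specialize (Hd j).
      assert (r0 <= t (x j)) by (apply (Hlow (N j)); [apply HX | lra]).
      revert Hsj; unfold Rabs; destruct Rcase_abs; lra.
    - destruct (Hs (s - 1 / 2) 0%nat) as [j [Hj Hsj]]; [lra|].
      specialize (t_range _ (HX j)); revert Hsj; unfold Rabs; destruct Rcase_abs; lra. }
  pose proof theta_pos as Hth.
  (* As the steps approach [s], [y0] is the limit of the images divided by [t (1 - t)], which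
     locates the classes, and [c] that of the images divided by [t], as in [images_apart]. *)
  pose (y0 := vscale V (/ (s * (1 - s))) p); pose (c := vscale V (/ s) p).
  destruct (a_local y0) as [r1 [Hr1 [L [_ HL]]]].
  destruct (list_bound L) as [M [HM HLM]].
  assert (Hnear : forall phi e, continuity_pt phi s -> 0 < e -> exists r, 0 < r /\
    forall j, Rabs (s - t (x j)) < r -> / INR (S j) < r ->
      q (vsub V (vscale V (phi s) p) (vscale V (phi (t (x j))) (f (N j) (x j)))) < e).
  { intros phi e Hphi He.
    destruct (seminorm_dist V d HF q (vscale V (phi s) p) e Hq Hqc He) as [e1 [He1 H1]].
    destruct (scale_continuous V d HF (phi s) p e1 He1) as [e2 [He2 H2]].
    destruct (continuity_pt_eps phi s e2 Hphi He2) as [e3 [He3 H3]].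
    exists (Rmin e2 e3); split; [now apply Rmin_glb_lt|].
    pose proof (Rmin_l e2 e3); pose proof (Rmin_r e2 e3).
    intros j Hj Hj'; apply H1, H2; [apply H3; lra | specialize (Hd j); lra]. }
  destruct (Hnear (fun b => / (b * (1 - b))) r1) as [e1 [He1 H1]]; [reg; nra | assumption |].
  destruct (Hnear (fun b => / b) (theta / 4)) as [e2 [He2 H2]]; [reg; lra | lra |].
  (* Two steps within [e] of [s] differ by at most [2 * e], and [2 * e * M <= theta / 2]. *)
  pose (e := Rmin (Rmin e1 e2) (theta / (4 * M))).
  assert (He : 0 < e /\ e <= e1 /\ e <= e2 /\ e <= theta / (4 * M)).
  { assert (0 < theta / (4 * M)) by (apply Rdiv_lt_0_compat; lra).
    unfold e; pose proof (Rmin_l (Rmin e1 e2) (theta / (4 * M)));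
      pose proof (Rmin_r (Rmin e1 e2) (theta / (4 * M)));
      pose proof (Rmin_l e1 e2); pose proof (Rmin_r e1 e2).
    split; [repeat apply Rmin_glb_lt|]; lra. }
  destruct He as [He [Hee1 [Hee2 HeM]]].
  destruct (inv_S_small e He) as [j1 Hj1].
  destruct (frequently_in_list (fun j => (j1 <= j)%nat /\ Rabs (s - t (x j)) < e)
              (fun j => a (scaled (x j))) L) as [b [Hb Hfreq]].
  { intros j; destruct (Hs e (Nat.max j j1) He) as [i [Hi Hsi]].
    exists i; split; [lia|]; split; [split; [lia | assumption]|].
    pose proof (Hj1 i ltac:(lia)) as Hi'.
    destruct (f_form (N i) (x i) (HX i)) as [k [u [_ [_ Hf]]]].
    pose proof (t_range _ (HX i)) as Hti.
    apply HL with (vscale V (/ (1 - t (x i)))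
      (mix V u (z (index (N i) k)) (z (index (N i) (S k))))).
    - apply union_subspace; apply union_subspace; apply union_subspace;
        eexists; apply F_next.
    - specialize (H1 i ltac:(lra) ltac:(lra)).
      rewrite Hf in H1; fold y0 in H1.
      set (w := mix V u _ _) in *; clearbody w.
      match goal with |- q ?l < _ => match type of H1 with q ?r < _ => replace l with r end end;
        [assumption|].
      unfold scaled, vsub, mix; clearbody y0; vec. }
  destruct (Hfreq 0%nat) as [i [_ [[Hi1 Hi] Hai]]].
  (* Searching from [S (N i)] on gives [N j >= j > N i], so the two indices differ. *)
  destruct (Hfreq (S (N i))) as [j [HjN [[Hj1' Hj] Haj]]].
  apply (images_apart (N i) (N j) (x i) (x j) b c); trivial.
  - specialize (HN j); lia.
  - apply H2; [lra | specialize (Hj1 i Hi1); lra].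
  - apply H2; [lra | specialize (Hj1 j Hj1'); lra].
  - specialize (HLM b Hb); pose proof (seminorm_pos V q b Hq).
    assert (Rabs (t (x i) - t (x j)) <= 2 * e).
    { revert Hi Hj; unfold Rabs; repeat destruct Rcase_abs; lra. }
    assert (e * M <= theta / 4).
    { apply Rle_trans with (theta / (4 * M) * M); [apply Rmult_le_compat_r; lra|].
      right; field; lra. }
    pose proof (Rabs_pos (t (x i) - t (x j))); nra.
Qed.

End Perturbation.

(** * Assembling the approximations *)

Lemma lfap_of_directions : LFAP d X.
Proof.
  intros cover Hopen Hcov.
  destruct (step_size cover Hopen Hcov) as [t [Ht [Htlip Htcov]]].
  destruct coset_choice as [a Ha].
  destruct (level_function t Ht Htlip a Ha) as [h [Hh [Hhlip Hlevel]]].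
  (* Because of the [+ 1], the integer part of [kappa x] is at least [/ h x] and hence a level of
     [x]. *)
  pose (kappa := fun x => / h x + 1).
  pose (f := fun n x => mix V (t x) x
     (path V (fun k => z (index n k)) (S (nat_floor (kappa x))) (kappa x))).
  assert (Hkappa : forall x, X x -> 1 <= / h x /\
    INR (nat_floor (kappa x)) <= kappa x < INR (nat_floor (kappa x)) + 1).
  { intros x Xx; specialize (Hh x Xx).
    assert (1 <= / h x) by (rewrite <- Rinv_1 at 1; apply Rinv_le_contravar; lra).
    split; [assumption|]; apply nat_floor_spec; unfold kappa; lra. }
  assert (Hform : forall n x, X x -> exists k u, 0 <= u <= 1 /\ at_level t a k x /\
            f n x = mix V (t x) x (mix V u (z (index n k)) (z (index n (S k))))).
  { intros n x Xx; destruct (Hkappa x Xx) as [H1 H2].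
    exists (nat_floor (kappa x)), (kappa x - INR (nat_floor (kappa x))).
    split; [lra|]; split.
    - apply Hlevel; [assumption|]; specialize (Hh x Xx); unfold kappa in H2 at 2.
      apply Rle_trans with (h x * / h x); [rewrite Rinv_r; lra|].
      apply Rmult_le_compat_l; unfold kappa in *; lra.
    - unfold f; f_equal; apply (path_value V (fun k => z (index n k))); [lia | lra]. }
  exists f; split; [|split].
  - intros n; split.
    + intros x Xx; destruct (Hform n x Xx) as [k [u [Hu [_ ->]]]].
      specialize (Ht x Xx); repeat apply mix_in; trivial; lra.
    + intros x e Xx He; specialize (Ht x Xx) as Htx; specialize (Hh x Xx) as Hhx.
      assert (Hct : cont_fun d X t x) by (apply cont_fun_lipschitz; auto).
      assert (Hck : cont_fun d X kappa x).
      { apply (cont_fun_comp d X (fun v => / v + 1) h); [reg; lra|].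
        apply cont_fun_lipschitz; auto. }
      (* The truncation of the path jumps with the integer part. While [kappa] changes by less than
         [1], the integer part stays below [m], so the fixed truncation [m] gives the same
         values. *)
      pose (m := S (S (nat_floor (kappa x)))).
      assert (Hc : cont_map d X
        (fun y => mix V (t y) y (path V (fun k => z (index n k)) m (kappa y))) x).
      { unfold mix; apply (cont_map_add V d HF).
        - apply (cont_map_scale V d HF X (fun y => 1 - t y)); [|apply cont_map_id].
          apply (cont_fun_comp d X (fun v => 1 - v) t); [reg | assumption].
        - apply (cont_map_scale V d HF X t); [assumption|].
          now apply (cont_map_path V d HF). }
      assert (Heq : forall y, X y -> Rabs (kappa x - kappa y) < 1 ->
                f n y = mix V (t y) y (path V (fun k => z (index n k)) m (kappa y))).
      { intros y Xy Hy; unfold f; f_equal.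
        destruct (Hkappa y Xy) as [_ Hky]; destruct (Hkappa x Xx) as [_ Hkx].
        rewrite !(path_value V (fun k => z (index n k)) _ (nat_floor (kappa y))); trivial;
          try lia; try lra.
        unfold m; apply INR_lt; rewrite !S_INR; revert Hy; unfold Rabs; destruct Rcase_abs; lra. }
      destruct (Hc e He) as [r [Hr Hrc]].
      destruct (Hck 1) as [s [Hs Hsk]]; [lra|].
      exists (Rmin r s); split; [now apply Rmin_glb_lt|].
      intros y Xy Hy; pose proof (Rmin_l r s); pose proof (Rmin_r r s).
      rewrite (Heq x), (Heq y); trivial; [apply Hrc; trivial; lra | apply Hsk; trivial; lra |].
      rewrite Rminus_diag, Rabs_R0; lra.
  - intros n x Xx; destruct (Hform n x Xx) as [k [u [Hu [_ ->]]]]; auto.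
  - intros p Xp.
    destruct (images_locally_finite t Ht Htlip a Ha f Hform p Xp) as [r [Hr [N HN]]].
    exists (fun y => X y /\ d p y < r); split; [split|split].
    + tauto.
    + intros y [Xy Hy]; exists (r - d p y); split; [lra|].
      intros w Xw Hw; split; [assumption|]; pose proof (dist_tri V d HF p y w); lra.
    + split; [assumption|]; now rewrite (dist_refl V d HF).
    + exists N; intros n [x [Xx [_ Hx]]]; now apply (HN n x).
Qed.

End Approximation.

Theorem theorem5 (E : Type) (V : RVectorSpace E) (d : E -> E -> R)
  (HF : frechet_space V d) (X : E -> Prop)
  (Hconv : convex V X) (Hnonsep : ~ separable d X) :
  LFAP d X.
Proof.
  destruct (not_small_seminorm V d HF X Hnonsep) as [q [Hq [Hqc Hsmall]]].
  destruct (far_bounded_sequence V d HF q X Hq Hsmall)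
    as [z [F [Hz [Hbd [Hsub [Hstep [Hnext Hfar]]]]]]].
  destruct (bounded_seminorm V d q z Hq Hqc Hbd) as [B [HB HzB]].
  exact (lfap_of_directions V d HF X Hconv q Hq Hqc z F Hz Hbd Hsub Hstep Hnext Hfar B HB HzB).
Qed.
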